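(* Let $\mathcal{X}$ be a pair of graphs, and let $\mathcal{P}_1$ and $\Omega_1$ be the collections of pairs defined in the context. Then every $\mathcal{X}$-free graph distinct from $C_5$ is perfect if and only if $\mathcal{X}$ belongs to $\mathcal{P}_1$. Similarly, every $\mathcal{X}$-free graph distinct from $C_5$ is $\omega$-colourable if and only if $\mathcal{X}$ belongs to $\Omega_1$.
   Context: Graphs are finite and simple and considered up to isomorphism (``distinct from $H$'' means not isomorphic to $H$). A graph $G$ is $\omega$-colourable if its chromatic number $\chi(G)$ equals its clique number $\omega(G)$; it is perfect if $\chi(G')=\omega(G')$ for every induced subgraph $G'$ of $G$. For a pair $\mathcal{X}$ of graphs, $G$ is $\mathcal{X}$-free if it contains no member of $\mathcal{X}$ as an induced subgraph. $K_n, P_n, C_n$ denote the complete graph, path and cycle on $n$ vertices; $G\cup H$ is disjoint union and $kG$ is the disjoint union of $k$ copies of $G$. $D$ is $K_4$ minus an edge; $Z_1$ is the graph obtained from $K_3$ by adding a pendant edge. $\mathcal{P}_1$ is the collection of all pairs $\mathcal{X}$ of graphs satisfying at least one of the following: (i) at least one of the graphs of $\mathcal{X}$ is an induced subgraph of $P_4$; (ii) $\mathcal{X}$ is $\{3K_1,K_3\}$ or $\{3K_1,Z_1\}$ or $\{3K_1,D\}$; (iii) $\mathcal{X}$ is $\{K_1\cup P_3,K_3\}$ or $\{K_1\cup P_3,Z_1\}$ or $\{K_1\cup P_3,D\}$; (iv) $\mathcal{X}$ is $\{2K_1\cup K_2,K_3\}$ or $\{2K_1\cup K_2,Z_1\}$.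 $\Omega_1$ consists of $\{2K_1\cup K_2,D\}$ and all pairs of $\mathcal{P}_1$. *)

(* Defs.v *)
From mathcomp Require Import all_boot.

Set Implicit Arguments.
Unset Strict Implicit.
Unset Printing Implicit Defensive.

(* Finite simple graphs; the graph with no vertices is allowed. *)
Record sgraph := SGraph {
  vertex :> finType;
  adj : rel vertex;
  adj_sym : symmetric adj;
  adj_irrefl : irreflexive adj
}.

Definition iso (G H : sgraph) : Prop :=
  exists2 f : G -> H, bijective f & forall x y, adj (f x) (f y) = adj x y.

Section Induced.
Variables (G : sgraph) (S : {set G}).

Definition induced_adj : rel {x | x \in S} := fun x y => adj (val x) (val y).

Lemma induced_adj_sym : symmetric induced_adj.
Proof. by move=> x y; apply: adj_sym. Qed.

Lemma induced_adj_irrefl : irreflexive induced_adj.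
Proof. by move=> x; apply: adj_irrefl. Qed.

Definition induced : sgraph := SGraph induced_adj_sym induced_adj_irrefl.
End Induced.

Definition induced_subgraph (H G : sgraph) : Prop :=
  exists S : {set G}, iso H (induced S).

Definition colourable (G : sgraph) (k : nat) : bool :=
  [exists c : {ffun G -> 'I_k}, [forall x, forall y, adj x y ==> (c x != c y)]].

Lemma ex_colourable (G : sgraph) : exists k, colourable G k.
Proof.
exists #|G|; apply/existsP; exists [ffun x => enum_rank x].
apply/forallP=> x; apply/forallP=> y; apply/implyP=> xy.
rewrite !ffunE (inj_eq enum_rank_inj).
by apply: contraTneq xy => ->; rewrite adj_irrefl.
Qed.

Definition chromatic_number (G : sgraph) : nat := ex_minn (ex_colourable G).

Definition clique (G : sgraph) (S : {set G}) : bool :=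
  [forall x in S, forall y in S, (x != y) ==> adj x y].

Definition clique_number (G : sgraph) : nat :=
  \max_(S : {set G} | clique S) #|S|.

Definition omega_colourable (G : sgraph) : Prop :=
  chromatic_number G = clique_number G.

Definition perfect (G : sgraph) : Prop :=
  forall S : {set G}, omega_colourable (induced S).

Section Complete.
Variable n : nat.

Definition complete_adj : rel 'I_n := fun x y => x != y.

Lemma complete_adj_sym : symmetric complete_adj.
Proof. by move=> x y; rewrite /complete_adj eq_sym. Qed.

Lemma complete_adj_irrefl : irreflexive complete_adj.
Proof. by move=> x; rewrite /complete_adj eqxx. Qed.

Definition complete_graph : sgraph :=
  SGraph complete_adj_sym complete_adj_irrefl.
End Complete.

Section Path.
Variable n : nat.

Definition path_adj : rel 'I_n := fun x y => (x.+1 == y) || (y.+1 == x).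

Lemma path_adj_sym : symmetric path_adj.
Proof. by move=> x y; rewrite /path_adj orbC. Qed.

Lemma path_adj_irrefl : irreflexive path_adj.
Proof. by move=> x; rewrite /path_adj orbb gtn_eqF. Qed.

Definition path_graph : sgraph := SGraph path_adj_sym path_adj_irrefl.
End Path.

(* [cycle_graph n] is the cycle on n vertices only for n >= 3; the conjunct
   [x != y] serves to exclude the loop that would arise for n = 1. *)
Section Cycle.
Variable n : nat.

Definition cycle_adj : rel 'I_n := fun x y =>
  (x != y) && ((x.+1 %% n == y) || (y.+1 %% n == x)).

Lemma cycle_adj_sym : symmetric cycle_adj.
Proof. by move=> x y; rewrite /cycle_adj eq_sym orbC. Qed.

Lemma cycle_adj_irrefl : irreflexive cycle_adj.
Proof. by move=> x; rewrite /cycle_adj eqxx. Qed.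

Definition cycle_graph : sgraph := SGraph cycle_adj_sym cycle_adj_irrefl.
End Cycle.

Section DisjointUnion.
Variables G H : sgraph.

Definition union_adj : rel (G + H) := fun x y =>
  match x, y with
  | inl a, inl b => adj a b
  | inr a, inr b => adj a b
  | _, _ => false
  end.

Lemma union_adj_sym : symmetric union_adj.
Proof. by move=> [a|a] [b|b] //=; apply: adj_sym. Qed.

Lemma union_adj_irrefl : irreflexive union_adj.
Proof. by move=> [a|a] /=; apply: adj_irrefl. Qed.

Definition disjoint_union : sgraph := SGraph union_adj_sym union_adj_irrefl.
End DisjointUnion.

Section Copies.
Variables (k : nat) (G : sgraph).

Definition copies_adj : rel ('I_k * G) := fun x y =>
  (x.1 == y.1) && adj x.2 y.2.

Lemma copies_adj_sym : symmetric copies_adj.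
Proof. by move=> x y; rewrite /copies_adj eq_sym adj_sym. Qed.

Lemma copies_adj_irrefl : irreflexive copies_adj.
Proof. by move=> x; rewrite /copies_adj adj_irrefl andbF. Qed.

Definition copies : sgraph := SGraph copies_adj_sym copies_adj_irrefl.
End Copies.

Section DeleteEdge.
Variables (G : sgraph) (u v : G).

Definition del_edge_adj : rel G := fun x y =>
  adj x y && ([set x; y] != [set u; v]).

Lemma del_edge_adj_sym : symmetric del_edge_adj.
Proof. by move=> x y; rewrite /del_edge_adj adj_sym setUC. Qed.

Lemma del_edge_adj_irrefl : irreflexive del_edge_adj.
Proof. by move=> x; rewrite /del_edge_adj adj_irrefl. Qed.

Definition del_edge : sgraph := SGraph del_edge_adj_sym del_edge_adj_irrefl.
End DeleteEdge.

(* The new vertex [None] is joined to [u] only. *)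
Section AddPendant.
Variables (G : sgraph) (u : G).

Definition pendant_adj : rel (option G) := fun x y =>
  match x, y with
  | Some a, Some b => adj a b
  | Some a, None | None, Some a => a == u
  | None, None => false
  end.

Lemma pendant_adj_sym : symmetric pendant_adj.
Proof. by move=> [a|] [b|] //=; apply: adj_sym. Qed.

Lemma pendant_adj_irrefl : irreflexive pendant_adj.
Proof. by move=> [a|] //=; apply: adj_irrefl. Qed.

Definition add_pendant : sgraph := SGraph pendant_adj_sym pendant_adj_irrefl.
End AddPendant.

Definition K1 : sgraph := complete_graph 1.
Definition K2 : sgraph := complete_graph 2.
Definition K3 : sgraph := complete_graph 3.
Definition K4 : sgraph := complete_graph 4.
Definition P3 : sgraph := path_graph 3.
Definition P4 : sgraph := path_graph 4.
Definition C5 : sgraph := cycle_graph 5.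
Definition D : sgraph := @del_edge K4 ord0 ord_max.
Definition Z1 : sgraph := @add_pendant K3 ord0.
Definition threeK1 : sgraph := copies 3 K1.
Definition K1_P3 : sgraph := disjoint_union K1 P3.
Definition twoK1_K2 : sgraph := disjoint_union (copies 2 K1) K2.

Definition graph_pair : Type := (sgraph * sgraph)%type.

(* Equality of unordered pairs, with graphs taken up to isomorphism. *)
Definition pair_is (X : graph_pair) (A B : sgraph) : Prop :=
  (iso X.1 A /\ iso X.2 B) \/ (iso X.1 B /\ iso X.2 A).

Definition free (X : graph_pair) (G : sgraph) : Prop :=
  ~ induced_subgraph X.1 G /\ ~ induced_subgraph X.2 G.

Definition calP1 (X : graph_pair) : Prop :=
  [\/ induced_subgraph X.1 P4 \/ induced_subgraph X.2 P4,
      [\/ pair_is X threeK1 K3, pair_is X threeK1 Z1 | pair_is X threeK1 D],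
      [\/ pair_is X K1_P3 K3, pair_is X K1_P3 Z1 | pair_is X K1_P3 D]
    | pair_is X twoK1_K2 K3 \/ pair_is X twoK1_K2 Z1].

Definition Omega1 (X : graph_pair) : Prop :=
  pair_is X twoK1_K2 D \/ calP1 X.

(* Main.v *)
Require Import Defs.
From mathcomp Require Import all_boot.

Set Implicit Arguments.
Unset Strict Implicit.
Unset Printing Implicit Defensive.

(** Necessity is a finite matter.  The graphs C5 + K1, its complement the wheel
    W5, C7, its complement, the blow-up of C5 with two consecutive vertices
    doubled, and the complement of that blow-up all have chromatic number above
    their clique number, so each of them contains a member of the pair
    ([hits_all_C5_K1]).  Suppose that no member is an induced subgraph of P4.
    Then C7 and its complement forbid C5 as a member, the graph C5 + K1 forces
    one member to contain P4 + K1 or to be one of 3K1, K1 + P3, 2K1 + K2, the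
    wheel forces the other to be the complement of such a graph, and the two
    blow-ups exclude P4 + K1 and its complement.  This leaves exactly the nine
    sparse/dense pairs of [Omega1].  A C5 with a triangle glued on an edge is
    free of 2K1 + K2 and of the diamond without being perfect, which removes
    that pair from [calP1].

    For sufficiency, a graph is perfect as soon as each nonempty induced
    subgraph has a stable set that meets all its maximum cliques
    ([omega_colourable_hitting]).  Without an induced P4, any maximum stable set
    does ([P4_free_hitting]).  The pairs of [calP1] with no member inside P4 are
    dominated by (K1 + P3, Z1), (K1 + P3, D) and (2K1 + K2, Z1).  Once a P4 is
    present, excluding such a pair leaves few possible neighbourhoods on this P4
    for a further vertex.  Five overlapping P4s show that no vertex can be added
    to a C5, so a graph containing C5 is C5.  Without C5, the graph is P4 itself,
    or two cliques joined by a matching ([cobip_hits]), or bipartite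
    ([perfect_paw_codiamond]), and a suitable stable set is visible.

    For the pair (2K1 + K2, D), a graph without K3 or without 3K1 falls under one
    of the perfect classes.  Otherwise the clique number is at least 3, and three
    colours suffice ([colourable3]): every vertex outside a maximum stable set I
    misses at most one vertex of I, and the missed vertex serves as a colour,
    except when some vertex misses none; then I takes one colour and the
    edges outside I lie on at most three vertices and form no triangle. *)

(** * Embeddings, colourings and cliques *)

Definition embedding (H G : sgraph) (f : H -> G) : Prop :=
  injective f /\ forall x y, adj (f x) (f y) = adj x y.

Lemma induced_subgraphP (H G : sgraph) :
  induced_subgraph H G <-> exists f : H -> G, embedding f.
Proof.
split=> [[S [g g_bij gE]]|[f [f_inj fE]]].
  exists (fun x => val (g x)); split; last exact: gE.
  exact: inj_comp val_inj (bij_inj g_bij).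
have fS x : f x \in f @: H by exact: imset_f.
exists (f @: H), (fun x => exist (fun z => z \in f @: H) (f x) (fS x)); last exact: fE.
apply: inj_card_bij; first by move=> x y [] /f_inj.
by rewrite card_sig card_imset.
Qed.

Lemma induced_subgraph_em (H G : sgraph) :
  induced_subgraph H G \/ ~ induced_subgraph H G.
Proof.
pose b := [exists f : {ffun H -> G},
  injectiveb f && [forall x, forall y, adj (f x) (f y) == adj x y]].
case: (boolP b) => [/existsP[f /andP[/injectiveP f_inj /forallP fE]]|/existsPn nf].
  by left; apply/induced_subgraphP; exists f; split=> // x y; apply/eqP/(forallP (fE x)).
right=> /induced_subgraphP[f [f_inj fE]]; case/negP: (nf (finfun f)).
apply/andP; split; first by apply/injectiveP=> x y; rewrite !ffunE => /f_inj.
by apply/forallP=> x; apply/forallP=> y; rewrite !ffunE fE.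
Qed.

Lemma induced_subgraph_refl (G : sgraph) : induced_subgraph G G.
Proof. by apply/induced_subgraphP; exists id; split. Qed.

Lemma induced_subgraph_trans (F G H : sgraph) :
  induced_subgraph F G -> induced_subgraph G H -> induced_subgraph F H.
Proof.
move=> /induced_subgraphP[f [f_inj fE]] /induced_subgraphP[g [g_inj gE]].
apply/induced_subgraphP; exists (g \o f); split; first exact: inj_comp.
by move=> x y /=; rewrite gE fE.
Qed.

Lemma induced_induced_subgraph (G : sgraph) (S : {set G}) :
  induced_subgraph (induced S) G.
Proof. by apply/induced_subgraphP; exists val; split=> //; exact: val_inj. Qed.

Lemma iso_induced_subgraph (G H : sgraph) : iso G H -> induced_subgraph G H.
Proof. by case=> f /bij_inj f_inj fE; apply/induced_subgraphP; exists f. Qed.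

Lemma iso_sym (G H : sgraph) : iso G H -> iso H G.
Proof.
by case=> f [g fK gK] fE; exists g; [exists f | move=> x y; rewrite -fE !gK].
Qed.

Lemma iso_trans (F G H : sgraph) : iso F G -> iso G H -> iso F H.
Proof.
case=> f f_bij fE [g g_bij gE]; exists (g \o f); first exact: bij_comp.
by move=> x y /=; rewrite gE fE.
Qed.

Lemma iso_card (G H : sgraph) : iso G H -> #|G| = #|H|.
Proof. by case=> f /bij_eq_card. Qed.

Lemma induced_subgraph_iso (H G : sgraph) :
  induced_subgraph H G -> #|G| <= #|H| -> iso H G.
Proof.
case/induced_subgraphP=> f [f_inj fE] le_card.
by exists f => //; exact: inj_card_bij.
Qed.

Lemma iso_induced_trans A B G :
  iso A B -> induced_subgraph B G -> induced_subgraph A G.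
Proof. by move=> /iso_induced_subgraph; exact: induced_subgraph_trans. Qed.

Lemma induced_iso_trans F A B :
  induced_subgraph F A -> iso A B -> induced_subgraph F B.
Proof. by move=> FA /iso_induced_subgraph; exact: induced_subgraph_trans. Qed.

Lemma not_induced_mono A B G : induced_subgraph A B ->
  ~ induced_subgraph A G -> ~ induced_subgraph B G.
Proof. by move=> AB nA BG; exact/nA/(induced_subgraph_trans AB). Qed.

Lemma colourableP (G : sgraph) (k : nat) :
  reflect (exists2 c : G -> nat, forall x, c x < k &
             forall x y, adj x y -> c x != c y)
          (colourable G k).
Proof.
apply: (iffP existsP) => [[c /forallP cP]|[c c_lt cP]].
  exists (fun x => val (c x)) => [x|x y xy]; first exact: ltn_ord.
  by move: (cP x) => /forallP/(_ y)/implyP/(_ xy).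
exists [ffun x => Ordinal (c_lt x)].
by apply/forallP=> x; apply/forallP=> y; rewrite !ffunE; apply/implyP/cP.
Qed.

Lemma cliqueP (G : sgraph) (S : {set G}) :
  reflect {in S &, forall x y, x != y -> adj x y} (clique S).
Proof.
apply: (iffP forall_inP) => [SP x y xS yS|SP x xS].
  by move: (SP x xS) => /forall_inP/(_ y yS)/implyP.
by apply/forall_inP=> y yS; apply/implyP/SP.
Qed.

Lemma clique_leq_number (G : sgraph) (S : {set G}) :
  clique S -> #|S| <= clique_number G.
Proof. exact: (@leq_bigmax_cond _ _ (fun S : {set G} => #|S|)). Qed.

Lemma max_clique_ex (G : sgraph) :
  exists2 K : {set G}, clique K & #|K| = clique_number G.
Proof.
have : 0 < #|[pred K : {set G} | clique K]|.
  by apply/card_gt0P; exists set0; apply/cliqueP=> x y; rewrite inE.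
by case/(eq_bigmax_cond (fun K : {set G} => #|K|)) => K Kc E; exists K.
Qed.

Lemma clique_leq_colours (G : sgraph) (k : nat) (S : {set G}) :
  colourable G k -> clique S -> #|S| <= k.
Proof.
case/colourableP=> c c_lt cP /cliqueP SP.
pose f x := Ordinal (c_lt x).
have f_inj : {in S &, injective f}.
  move=> x y xS yS [] /eqP; apply: contraTeq => xy.
  exact/cP/SP.
by rewrite -(card_in_imset f_inj) -[leqRHS]card_ord max_card.
Qed.

Lemma colourable_leq (G : sgraph) (k m : nat) :
  k <= m -> colourable G k -> colourable G m.
Proof.
move=> km /colourableP[c c_lt cP]; apply/colourableP; exists c => // x.
exact: leq_trans (c_lt x) km.
Qed.

Lemma omega_colourableP (G : sgraph) :
  omega_colourable G <-> colourable G (clique_number G).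
Proof.
rewrite /omega_colourable /chromatic_number; case: ex_minnP => k kc kmin.
split=> [<- //|Gc]; apply/eqP; rewrite eqn_leq kmin //=.
by have [K Kc <-] := max_clique_ex G; exact: clique_leq_colours Kc.
Qed.

Lemma induced_subgraph_colourable (H G : sgraph) (k : nat) :
  induced_subgraph H G -> colourable G k -> colourable H k.
Proof.
case/induced_subgraphP=> f [_ fE] /colourableP[c c_lt cP].
apply/colourableP; exists (c \o f) => [x|x y xy] /=; first exact: c_lt.
by apply: cP; rewrite fE.
Qed.

Lemma embedding_clique (H G : sgraph) (f : H -> G) (K : {set H}) :
  embedding f -> clique K -> clique (f @: K).
Proof.
move=> [f_inj fE] /cliqueP KP; apply/cliqueP=> _ _ /imsetP[x xK ->] /imsetP[y yK ->].
by rewrite fE (inj_eq f_inj); exact: KP.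
Qed.

Lemma induced_subgraph_clique_number (H G : sgraph) :
  induced_subgraph H G -> clique_number H <= clique_number G.
Proof.
case/induced_subgraphP=> f fe; have [K Kc <-] := max_clique_ex H.
rewrite -(card_imset _ (proj1 fe)); apply: clique_leq_number.
exact: embedding_clique.
Qed.

Lemma iso_omega_colourable (G H : sgraph) :
  iso G H -> omega_colourable G -> omega_colourable H.
Proof.
move=> GH /omega_colourableP Gc; apply/omega_colourableP.
have HG := iso_sym GH.
apply: colourable_leq (induced_subgraph_colourable (iso_induced_subgraph HG) Gc).
exact/induced_subgraph_clique_number/iso_induced_subgraph.
Qed.

Lemma perfect_induced_subgraph (G H : sgraph) :
  perfect G -> induced_subgraph H G -> omega_colourable H.
Proof. by move=> Gp [S /iso_sym HS]; exact: iso_omega_colourable HS (Gp S). Qed.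

Definition stable (G : sgraph) (I : {set G}) : Prop :=
  {in I &, forall x y, ~~ adj x y}.

(** Phrased without the clique number, so that a proof may simply exhibit a
    larger clique than any given clique disjoint from [I]. *)
Definition hits_max_cliques (G : sgraph) (I : {set G}) : Prop :=
  forall K : {set G}, clique K -> [disjoint K & I] ->
    exists2 L : {set G}, clique L & #|K| < #|L|.

(** Removing a stable set that meets all maximum cliques lowers the clique number
    by at least one and costs one colour; the remaining graph is an induced
    subgraph, so induction applies to it. *)
Lemma omega_colourable_hitting (G : sgraph) :
  (forall H, induced_subgraph H G -> 0 < #|H| ->
     exists2 I : {set H}, stable I & hits_max_cliques I) ->
  omega_colourable G.
Proof.
have [n] := ubnP #|G|; elim: n G => // n IHn G leGn hG; apply/omega_colourableP.
have [G0|Gpos] := posnP #|G|.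
  apply/colourableP; exists (fun=> 0) => [x|x]; by have := fintype0 x.
have [I Ist Ihit] := hG G (induced_subgraph_refl G) Gpos.
have [I0|[z zI]] := set_0Vmem I.
  have [K Kc Kmax] := max_clique_ex G.
  have [|L Lc] := Ihit K Kc; first by rewrite I0 disjoint_sym disjoints_subset sub0set.
  by rewrite Kmax ltnNge clique_leq_number.
pose H := induced (~: I); have HG := induced_induced_subgraph (~: I).
have /omega_colourableP Hc : omega_colourable H.
  apply: IHn => [|F FH]; last exact/hG/(induced_subgraph_trans FH).
  apply: (@leq_trans #|G|); last by rewrite -ltnS.
  rewrite card_sig cardsCs setCK ltn_subrL Gpos andbT.
  by apply/card_gt0P; exists z.
have lt_omega : clique_number H < clique_number G.
  have [K Kc <-] := max_clique_ex H.
  have ve : embedding (val : H -> G) by split=> //; exact: val_inj.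
  rewrite -(card_imset _ (@val_inj _ _ H)).
  have [|L Lc ltL] := Ihit _ (embedding_clique ve Kc).
    rewrite disjoints_subset; apply/subsetP=> _ /imsetP[x _ ->]; exact: (valP x).
  exact: leq_trans ltL (clique_leq_number Lc).
apply: colourable_leq lt_omega _.
have /colourableP[c c_lt cP] := Hc.
pose d x := if insub x is Some y then c (y : H) else clique_number H.
apply/colourableP; exists d => [x|x y xy]; rewrite /d.
  by case: insubP => // u _ _; exact: leqW.
case: insubP => [u _ ux|xI]; case: insubP => [v _ vy|yI].
- by apply: cP; rewrite -ux -vy in xy.
- by rewrite neq_ltn c_lt.
- by rewrite neq_ltn c_lt orbT.
- rewrite !inE !negbK in xI yI; by have := Ist x y xI yI; rewrite xy.
Qed.

Lemma perfect_hitting (G : sgraph) :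
  (forall H, induced_subgraph H G -> 0 < #|H| ->
     exists2 I : {set H}, stable I & hits_max_cliques I) ->
  perfect G.
Proof.
move=> hG S; apply: omega_colourable_hitting => H HS; apply: hG.
exact: induced_subgraph_trans HS (induced_induced_subgraph S).
Qed.

(** * Graphs on initial segments of the naturals, decided by computation *)

(** Embeddings and colourings are both assignments of values below [m] to the
    variables below [k] subject to binary constraints, where [R i j a b] allows
    the values [a] and [b] for the variables [i < j].  Extending partial solutions
    one variable at a time prunes the search enough for evaluation in the kernel. *)
Fixpoint solutions (R : nat -> nat -> nat -> nat -> bool) (m k : nat) :
    seq (seq nat) :=
  if k is k'.+1 then
    [seq rcons w a | w <- solutions R m k',
       a <- [seq a <- iota 0 m | all (fun i => R i k' (nth 0 w i) a) (iota 0 k')]]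
  else [:: [::]].

Definition solvable R m k : bool := solutions R m k != [::].

Lemma solutionsP (R : nat -> nat -> nat -> nat -> bool) m k (w : seq nat) :
  reflect [/\ size w = k, forall i, i < k -> nth 0 w i < m &
             forall i j, i < j -> j < k -> R i j (nth 0 w i) (nth 0 w j)]
          (w \in solutions R m k).
Proof.
elim: k w => [|k IHk] w /=.
  rewrite inE; apply: (iffP eqP) => [->|[/size0nil ->]] //.
apply: (iffP allpairsPdep) => [[v [a [/IHk[<- v_lt vR]]]]|[sw w_lt wR]].
  rewrite mem_filter mem_iota add0n => /andP[/allP aR am] ->.
  rewrite size_rcons; split=> // [i|i j ij]; rewrite ltnS leq_eqVlt !nth_rcons.
    by case/orP=> [/eqP ->|lti]; rewrite ?ltnn ?eqxx // lti v_lt.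
  case/orP=> [/eqP ej|ltj].
    by rewrite -ej ij ltnn eqxx ej; apply: aR; rewrite mem_iota -ej ij.
  by rewrite (ltn_trans ij ltj) ltj vR.
case/lastP: w => // v a in sw w_lt wR *.
rewrite size_rcons in sw; case: sw => sv.
have nv i : i < k -> nth 0 (rcons v a) i = nth 0 v i by rewrite nth_rcons sv => ->.
have na : nth 0 (rcons v a) k = a by rewrite nth_rcons sv ltnn eqxx.
exists v, a; split=> //.
  apply/IHk; split=> // [i ik|i j ij jk]; first by rewrite -nv // w_lt // leqW.
  by rewrite -!nv // ?(ltn_trans ij jk) // wR // leqW.
have am : a < m by rewrite -na w_lt.
rewrite mem_filter mem_iota add0n am !andbT.
apply/allP=> i; rewrite mem_iota add0n => /= ik.
by have := wR i k ik (ltnSn k); rewrite na nv.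
Qed.

Lemma solvableP (R : nat -> nat -> nat -> nat -> bool) m k :
  reflect (exists2 g : nat -> nat, forall i, i < k -> g i < m &
             forall i j, i < j -> j < k -> R i j (g i) (g j))
          (solvable R m k).
Proof.
apply: (iffP idP) => [|[g g_lt gR]]; rewrite /solvable.
  case E: (solutions R m k) => [//|w s] _.
  have /solutionsP[_ w_lt wR] : w \in solutions R m k by rewrite E mem_head.
  by exists (nth 0 w).
apply/eqP=> E; have : mkseq g k \in solutions R m k; last by rewrite E.
apply/solutionsP; split=> [|i ik|i j ij jk]; rewrite ?size_mkseq // !nth_mkseq //.
- exact: g_lt.
- exact: gR.
- exact: ltn_trans jk.
Qed.

Section NatGraph.
Variables (n : nat) (e : rel nat).

(** Any relation is made symmetric and irreflexive, so that a concrete graph can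
    be given by listing each edge once, without proof obligations. *)
Definition sym_adj : rel nat := fun i j => (i != j) && (e i j || e j i).

Definition nat_adj : rel 'I_n := fun i j => sym_adj i j.

Lemma nat_adj_sym : symmetric nat_adj.
Proof. by move=> i j; rewrite /nat_adj /sym_adj eq_sym orbC. Qed.

Lemma nat_adj_irrefl : irreflexive nat_adj.
Proof. by move=> i; rewrite /nat_adj /sym_adj eqxx. Qed.

Definition nat_graph : sgraph := SGraph nat_adj_sym nat_adj_irrefl.
End NatGraph.

Lemma sym_adj_sym e : symmetric (sym_adj e).
Proof. by move=> i j; rewrite /sym_adj eq_sym orbC. Qed.

Lemma sym_adj_irrefl e : irreflexive (sym_adj e).
Proof. by move=> i; rewrite /sym_adj eqxx. Qed.

Lemma ltn_wlog (P : nat -> nat -> Prop) n :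
  (forall i, P i i) -> (forall i j, P i j -> P j i) ->
  (forall i j, i < j -> j < n -> P i j) ->
  forall i j, i < n -> j < n -> P i j.
Proof.
move=> P0 Ps Plt i j lti ltj; case: (ltngtP i j) => [ij|ji|->] //.
  exact: Plt.
exact/Ps/Plt.
Qed.

Lemma nat_graph_embedding (G : sgraph) (n : nat) (e : rel nat) (s : nat -> G) :
  (forall i j, i < j -> j < n ->
     (s i != s j) && (adj (s i) (s j) == sym_adj e i j)) ->
  induced_subgraph (nat_graph n e) G.
Proof.
move=> sP; apply/induced_subgraphP; exists (fun i : 'I_n => s i).
have sE (i j : 'I_n) :
    (i == j :> nat) || (s i != s j) && (adj (s i) (s j) == sym_adj e i j).
  apply: (@ltn_wlog
    (fun a b => (a == b) || (s a != s b) && (adj (s a) (s b) == sym_adj e a b)) n)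
    => // [a|a b|a b ab bn]; first by rewrite eqxx.
    by rewrite eq_sym (eq_sym (s b)) adj_sym sym_adj_sym.
  by rewrite sP ?orbT.
split=> i j.
  by move=> ij; apply/val_inj/eqP; move: (sE i j); rewrite ij eqxx orbF.
case/orP: (sE i j) => [/eqP/val_inj ->|/andP[_ /eqP ->]] //.
by rewrite !adj_irrefl.
Qed.

Lemma nat_graph0_induced_subgraph (G : sgraph) (e : rel nat) :
  induced_subgraph (nat_graph 0 e) G.
Proof.
apply/induced_subgraphP.
by exists (fun x : 'I_0 => False_rect _ (notF (ltn_ord x))); split=> -[].
Qed.

Definition nat_embeds (k : nat) (d : rel nat) (m : nat) (e : rel nat) : bool :=
  solvable (fun i j a b => (a != b) && (sym_adj d i j == sym_adj e a b)) m k.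

Lemma nat_embedsP k d m e :
  reflect (induced_subgraph (nat_graph k d) (nat_graph m e)) (nat_embeds k d m e).
Proof.
apply: (iffP (solvableP _ _ _)) => [[g g_lt gP]|].
  case: m => [|m] in g_lt *.
    case: k => [|k] in g_lt gP *; last by have := g_lt 0 isT.
    exact: nat_graph0_induced_subgraph.
  apply: (@nat_graph_embedding _ _ _ (fun i => inord (g i) : nat_graph m.+1 e)).
  move=> i j ij jk; have ik := ltn_trans ij jk.
  rewrite -(inj_eq val_inj) /= /nat_adj !inordK ?g_lt //.
  by have := gP i j ij jk; rewrite eq_sym [_ == sym_adj e _ _]eq_sym.
case/induced_subgraphP=> f [f_inj fE].
pose g i := if insub i is Some x then val (f x) else 0.
exists g => [i ik|i j ij jk]; first by rewrite /g insubT ltn_ord.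
have ik := ltn_trans ij jk; rewrite /g !insubT /=.
pose x : nat_graph k d := Sub i ik; pose y : nat_graph k d := Sub j jk.
have -> : sym_adj d i j = sym_adj e (f x) (f y) := esym (fE x y).
by rewrite eqxx andbT (inj_eq val_inj) (inj_eq f_inj) -(inj_eq val_inj) /= neq_ltn ij.
Qed.

Ltac decide_embeds := by apply/nat_embedsP; vm_compute.
Ltac decide_not_embeds := let H := fresh in move=> H; exfalso; move: H; decide_embeds.

Lemma nat_graph_colourableP n e k :
  reflect (colourable (nat_graph n e) k)
          (solvable (fun i j a b => sym_adj e i j ==> (a != b)) k n).
Proof.
apply: (iffP (solvableP _ _ _)) => [[g g_lt gP]|/colourableP[c c_lt cP]].
  apply/colourableP; exists (fun i => g (val i)) => [i|i j ij]; first exact/g_lt/ltn_ord.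
  apply: (@ltn_wlog (fun a b => sym_adj e a b -> g a != g b) n) => //.
  - by move=> a; rewrite sym_adj_irrefl.
  - by move=> a b; rewrite sym_adj_sym eq_sym.
  - by move=> a b ab bn; apply/implyP/gP.
  - exact: ltn_ord.
  - exact: ltn_ord.
pose g i := if insub i is Some x then c x else 0.
exists g => [i ik|i j ij jk]; first by rewrite /g insubT.
have ik := ltn_trans ij jk; rewrite /g !insubT /=.
by apply/implyP=> e_ij; apply: cP.
Qed.

Lemma clique_embedding (G : sgraph) (K : {set G}) (k : nat) :
  clique K -> k <= #|K| -> induced_subgraph (nat_graph k (fun _ _ => true)) G.
Proof.
move=> /cliqueP KP kK; case: k => [|k] in kK *.
  exact: nat_graph0_induced_subgraph.
have [x0 x0K] : exists x, x \in K by apply/card_gt0P; exact: leq_trans kK.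
apply: (@nat_graph_embedding _ _ _ (nth x0 (enum K))) => i j ij jk.
have jK : j < size (enum K) by rewrite -cardE; exact: leq_trans kK.
have iK := ltn_trans ij jK.
have mK l : l < size (enum K) -> nth x0 (enum K) l \in K.
  by move=> lK; rewrite -mem_enum mem_nth.
have neq : nth x0 (enum K) i != nth x0 (enum K) j.
  by rewrite nth_uniq ?enum_uniq // neq_ltn ij.
by rewrite neq KP ?mK // /sym_adj neq_ltn ij.
Qed.

Lemma nat_graph_not_omega_colourable n e k :
  ~~ nat_embeds k.+1 (fun _ _ => true) n e ->
  ~~ solvable (fun i j a b => sym_adj e i j ==> (a != b)) k n ->
  ~ omega_colourable (nat_graph n e).
Proof.
move=> /nat_embedsP noK /nat_graph_colourableP noc /omega_colourableP Gc; apply: noc.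
apply: colourable_leq Gc; rewrite leqNgt; apply/negP=> lt_k; apply: noK.
have [K Kc KE] := max_clique_ex (nat_graph n e).
by apply: clique_embedding Kc _; rewrite KE.
Qed.

(** The induced subgraphs of a graph on [n] naturals are, up to isomorphism, its
    restrictions to sublists of [iota 0 n]; claims about all of them reduce to one
    evaluation. *)
Fixpoint sublists (s : seq nat) : seq (seq nat) :=
  if s is x :: t then map (cons x) (sublists t) ++ sublists t else [:: [::]].

Lemma filter_sublists (p : pred nat) (s : seq nat) : filter p s \in sublists s.
Proof.
elim: s => //= x s IHs; rewrite mem_cat; case: ifP => _; last by rewrite IHs orbT.
by rewrite map_f.
Qed.

Definition restrict (e : rel nat) (l : seq nat) : rel nat :=
  fun i j => sym_adj e (nth 0 l i) (nth 0 l j).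

Lemma induced_nat_graph (A : sgraph) (n : nat) (e : rel nat) :
  induced_subgraph A (nat_graph n e) ->
  exists2 l, l \in sublists (iota 0 n) & iso A (nat_graph (size l) (restrict e l)).
Proof.
case/induced_subgraphP=> f [f_inj fE].
pose F x := val (f x).
have F_inj : injective F by move=> x y /val_inj/f_inj.
(* Listing A in the order of its image makes the image an increasing list. *)
pose s := sort (relpre F leq) (enum A).
have s_uniq : uniq s by rewrite sort_uniq enum_uniq.
have s_sorted : sorted (relpre F leq) s by apply: sort_sorted => x y; exact: leq_total.
pose l := map F s.
have lE : l = filter [in l] (iota 0 n).
  apply: (irr_sorted_eq ltn_trans ltnn).
  - by rewrite ltn_sorted_uniq_leq map_inj_uniq // s_uniq sorted_map.
  - by apply: sorted_filter (iota_ltn_sorted 0 n); exact: ltn_trans.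
  - move=> i; rewrite mem_filter mem_iota add0n /=; case: (boolP (i \in l)) => //.
    by case/mapP=> x _ ->; rewrite ltn_ord.
exists l; first by rewrite lE filter_sublists.
apply: iso_sym; apply: induced_subgraph_iso; last first.
  by rewrite card_ord size_map size_sort -cardE.
have [x0 _|A0] := fintype.pickP (@predT A); last first.
  have sz : size l = 0 by rewrite size_map size_sort -cardE; apply: eq_card0.
  by rewrite sz; exact: nat_graph0_induced_subgraph.
apply: (@nat_graph_embedding _ _ _ (nth x0 s)) => i j ij; rewrite size_map => js.
have is_ := ltn_trans ij js.
have neq : nth x0 s i != nth x0 s j by rewrite nth_uniq // neq_ltn ij.
rewrite neq -fE {1}/sym_adj /restrict neq_ltn ij /= (sym_adj_sym e (nth 0 l j)) orbb.
by rewrite !(nth_map x0).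
Qed.

(** * Concrete graphs *)

Definition edges (s : seq (nat * nat)) : rel nat := fun i j => (i, j) \in s.
Definition co (e : rel nat) : rel nat := fun i j => ~~ sym_adj e i j.

Definition nK3 := nat_graph 3 (fun _ _ => true).
Definition n3K1 := nat_graph 3 (edges [::]).
Definition path_rel : rel nat := fun i j => i.+1 == j.
Definition nP4 := nat_graph 4 path_rel.
Definition cycle_rel n : rel nat := fun i j => i.+1 %% n == j.
Definition nC5 := nat_graph 5 (cycle_rel 5).
Definition Z1_rel := edges [:: (0, 1); (1, 2); (0, 2); (0, 3)].
Definition K1_P3_rel := edges [:: (0, 1); (1, 2)].
Definition twoK1_K2_rel := edges [:: (0, 1)].
Definition D_rel := co (edges [:: (2, 3)]).
Definition nZ1 := nat_graph 4 Z1_rel.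
Definition nK1_P3 := nat_graph 4 K1_P3_rel.
Definition n2K1_K2 := nat_graph 4 twoK1_K2_rel.
Definition nD := nat_graph 4 D_rel.

Lemma iso_nat_graph (G : sgraph) (n : nat) (e : rel nat) (s : nat -> G) :
  #|G| = n ->
  (forall i j, i < j -> j < n ->
     (s i != s j) && (adj (s i) (s j) == sym_adj e i j)) ->
  iso G (nat_graph n e).
Proof.
move=> Gn sP; apply: iso_sym; apply: induced_subgraph_iso; last by rewrite card_ord Gn.
exact: nat_graph_embedding sP.
Qed.

Lemma iso_P4 : iso P4 nP4.
Proof.
apply: (@iso_nat_graph P4 _ _ (fun i => inord i : 'I_4)) => [|i j]; first exact: card_ord.
rewrite -val_eqE /= /path_adj.
move=> ij j4; rewrite !inordK ?(ltn_trans ij) //.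
by rewrite /sym_adj neq_ltn ij eqxx.
Qed.

Lemma iso_C5 : iso C5 nC5.
Proof.
apply: (@iso_nat_graph C5 _ _ (fun i => inord i : 'I_5)) => [|i j]; first exact: card_ord.
rewrite -val_eqE /= /cycle_adj.
move=> ij j4; rewrite -val_eqE /= !inordK ?(ltn_trans ij) //.
by rewrite /sym_adj neq_ltn ij eqxx.
Qed.

Lemma iso_K3 : iso K3 nK3.
Proof.
apply: (@iso_nat_graph K3 _ _ (fun i => inord i : 'I_3)) => [|i j]; first exact: card_ord.
rewrite /= /complete_adj -val_eqE.
by move=> ij j4; rewrite /= !inordK ?(ltn_trans ij) // /sym_adj neq_ltn ij.
Qed.

Definition ord3 : seq 'I_3 := [:: @Ordinal 3 0 isT; @Ordinal 3 1 isT; @Ordinal 3 2 isT].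

Lemma iso_3K1 : iso threeK1 n3K1.
Proof.
pose s : seq threeK1 := [seq (i, ord0) | i <- ord3].
apply: (@iso_nat_graph threeK1 _ _ (nth (ord0, ord0) s)) => [|i j].
  by rewrite card_prod !card_ord.
by move: i j => [|[|[|i]]] [|[|[|j]]].
Qed.

Lemma iso_K1_P3 : iso K1_P3 nK1_P3.
Proof.
pose s : seq K1_P3 := rcons [seq inr i | i <- ord3] (inl ord0).
apply: (@iso_nat_graph K1_P3 _ _ (nth (inl ord0) s)) => [|i j].
  by rewrite card_sum !card_ord.
by move: i j => [|[|[|[|i]]]] [|[|[|[|j]]]].
Qed.

Lemma iso_2K1_K2 : iso twoK1_K2 n2K1_K2.
Proof.
pose s : seq twoK1_K2 :=
  [:: inr ord0; inr ord_max; inl (ord0, ord0); inl (ord_max, ord0)].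
apply: (@iso_nat_graph twoK1_K2 _ _ (nth (inl (ord0, ord0)) s)) => [|i j].
  by rewrite card_sum card_prod !card_ord.
by move: i j => [|[|[|[|i]]]] [|[|[|[|j]]]].
Qed.

Lemma iso_Z1 : iso Z1 nZ1.
Proof.
pose s : seq Z1 := rcons [seq Some i | i <- ord3] None.
apply: (@iso_nat_graph Z1 _ _ (nth None s)) => [|i j].
  by rewrite card_option !card_ord.
by move: i j => [|[|[|[|i]]]] [|[|[|[|j]]]].
Qed.

Lemma iso_D : iso D nD.
Proof.
pose s : seq D := [:: @Ordinal 4 1 isT; @Ordinal 4 2 isT; ord0; ord_max].
apply: (@iso_nat_graph D _ _ (nth ord0 s)) => [|i j]; first exact: card_ord.
rewrite /adj /= /del_edge_adj eqEsubset !subUset !sub1set !inE.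
by move: i j => [|[|[|[|i]]]] [|[|[|[|j]]]].
Qed.

Lemma induced_subgraph_named (A B : sgraph) k d m e : iso A (nat_graph k d) ->
  iso B (nat_graph m e) -> nat_embeds k d m e -> induced_subgraph A B.
Proof.
move=> Ad Be /nat_embedsP de.
exact: iso_induced_trans Ad (induced_iso_trans de (iso_sym Be)).
Qed.

Definition C5_K1_rel : rel nat := fun i j => [&& i < 5, j < 5 & cycle_rel 5 i j].

(** C5 with the vertices 0 and 1 replaced by two nonadjacent twins each, the
    twin of [i] being [i + 5]. *)
Definition blowup_rel : rel nat := fun i j => (i %% 5).+1 %% 5 == j %% 5.

Definition C5_K1 := nat_graph 6 C5_K1_rel.

(** C5 is self-complementary, so the complement of C5 + K1 is C5 plus a
    universal vertex. *)
Definition W5 := nat_graph 6 (co C5_K1_rel).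
Definition C7 := nat_graph 7 (cycle_rel 7).
Definition coC7 := nat_graph 7 (co (cycle_rel 7)).
Definition blowup := nat_graph 7 blowup_rel.
Definition co_blowup := nat_graph 7 (co blowup_rel).

Lemma C5_K1_not_omega_colourable : ~ omega_colourable C5_K1.
Proof. by apply: (@nat_graph_not_omega_colourable _ _ 2); vm_compute. Qed.

Lemma W5_not_omega_colourable : ~ omega_colourable W5.
Proof. by apply: (@nat_graph_not_omega_colourable _ _ 3); vm_compute. Qed.

Lemma C7_not_omega_colourable : ~ omega_colourable C7.
Proof. by apply: (@nat_graph_not_omega_colourable _ _ 2); vm_compute. Qed.

Lemma coC7_not_omega_colourable : ~ omega_colourable coC7.
Proof. by apply: (@nat_graph_not_omega_colourable _ _ 3); vm_compute. Qed.

Lemma blowup_not_omega_colourable : ~ omega_colourable blowup.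
Proof. by apply: (@nat_graph_not_omega_colourable _ _ 2); vm_compute. Qed.

Lemma co_blowup_not_omega_colourable : ~ omega_colourable co_blowup.
Proof. by apply: (@nat_graph_not_omega_colourable _ _ 3); vm_compute. Qed.

Lemma C5_not_omega_colourable : ~ omega_colourable nC5.
Proof. by apply: (@nat_graph_not_omega_colourable _ _ 2); vm_compute. Qed.

(** * Necessity *)

(** The shape of all the classifications below: an induced subgraph of a given
    graph lies inside P4, or contains a certain graph, or is one of a short list. *)
Lemma induced_subgraph_cases (n : nat) (e : rel nat) (m : nat) (r : rel nat)
    (L : seq (nat * rel nat)) :
  all (fun l => let k := size l in let d := restrict e l in
         [|| nat_embeds k d 4 path_rel, nat_embeds m r k d
           | has (fun B => (B.1 == k) && nat_embeds k d B.1 B.2) L])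
      (sublists (iota 0 n)) ->
  forall A, induced_subgraph A (nat_graph n e) ->
  [\/ induced_subgraph A nP4, induced_subgraph (nat_graph m r) A
    | exists2 i, i < size L &
        iso A (nat_graph (nth (0, r) L i).1 (nth (0, r) L i).2)].
Proof.
move=> /allP all_l A /induced_nat_graph[l /all_l H Al].
case/or3P: H => [/nat_embedsP H|/nat_embedsP H|/(has_nthP (0, r))[i iL]].
- by constructor 1; exact: iso_induced_trans H.
- by constructor 2; exact: induced_iso_trans H (iso_sym Al).
case/andP=> /eqP sz /nat_embedsP H; constructor 3; exists i => //.
by apply: iso_trans Al _; apply: induced_subgraph_iso H _; rewrite !card_ord sz.
Qed.

Definition P4_K1_rel : rel nat := fun i j => (j < 4) && path_rel i j.
Definition P4_K1 := nat_graph 5 P4_K1_rel.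
Definition gem := nat_graph 5 (co P4_K1_rel).

Lemma induced_C5_K1 A : induced_subgraph A C5_K1 ->
  [\/ induced_subgraph A nP4, iso A nC5, induced_subgraph P4_K1 A
    | [\/ iso A n3K1, iso A nK1_P3 | iso A n2K1_K2]].
Proof.
pose L := [:: (5, cycle_rel 5); (3, edges [::]); (4, K1_P3_rel); (4, twoK1_K2_rel)].
case/(@induced_subgraph_cases _ _ 5 P4_K1_rel L) => [|AP|PA|]; first by vm_compute.
- by constructor 1.
- by constructor 3.
case=> -[|[|[|[|i]]]] //= _ AB; first by constructor 2.
- by constructor 4; constructor 1.
- by constructor 4; constructor 2.
- by constructor 4; constructor 3.
Qed.

Lemma induced_W5 A : induced_subgraph A W5 ->
  [\/ induced_subgraph A nP4, iso A nC5, induced_subgraph gem A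
    | [\/ iso A nK3, iso A nZ1 | iso A nD]].
Proof.
pose L := [:: (5, cycle_rel 5); (3, fun _ _ => true); (4, Z1_rel); (4, D_rel)].
case/(@induced_subgraph_cases _ _ 5 (co P4_K1_rel) L) => [|AP|PA|]; first by vm_compute.
- by constructor 1.
- by constructor 3.
case=> -[|[|[|[|i]]]] //= _ AB; first by constructor 2.
- by constructor 4; constructor 1.
- by constructor 4; constructor 2.
- by constructor 4; constructor 3.
Qed.

(** C7 has no triangle and its complement no stable triple, so a common induced
    subgraph is a linear forest with at most two pairwise nonadjacent vertices;
    apart from the induced subgraphs of P4 this only allows 2K2, whose complement
    C4 is not in C7. *)
Lemma induced_C7_coC7 A :
  induced_subgraph A C7 -> induced_subgraph A coC7 -> induced_subgraph A nP4.
Proof.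
pose L := [:: (4, edges [:: (0, 1); (2, 3)])].
case/(@induced_subgraph_cases _ _ 3 (edges [::]) L) => [|//|TA|]; first by vm_compute.
  move/(induced_subgraph_trans TA); decide_not_embeds.
case=> -[|i] //= _ /iso_sym/iso_induced_trans AB /AB; decide_not_embeds.
Qed.

Definition hits (X : graph_pair) (G : sgraph) : Prop :=
  induced_subgraph X.1 G \/ induced_subgraph X.2 G.

Lemma nfree_hits X G : ~ free X G -> hits X G.
Proof.
case: (induced_subgraph_em X.1 G) => [|n1]; first by left.
case: (induced_subgraph_em X.2 G) => [|n2]; first by right.
by case; split.
Qed.

Definition sparse_dense (A B : sgraph) : Prop :=
  [\/ iso A n3K1, iso A nK1_P3 | iso A n2K1_K2] /\ [\/ iso B nK3, iso B nZ1 | iso B nD].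

Lemma sparse_3K1 A : [\/ iso A n3K1, iso A nK1_P3 | iso A n2K1_K2] ->
  induced_subgraph n3K1 A.
Proof. by case=> /iso_sym AB; apply: induced_iso_trans AB; decide_embeds. Qed.

Lemma dense_K3 A : [\/ iso A nK3, iso A nZ1 | iso A nD] -> induced_subgraph nK3 A.
Proof. by case=> /iso_sym AB; apply: induced_iso_trans AB; decide_embeds. Qed.

Definition hits_all X :=
  [/\ hits X W5, hits X C7, hits X coC7, hits X blowup & hits X co_blowup].

(** A member equal to C5 is impossible because C7 and its complement would force
    the other member into P4.  In the remaining cases [A] contains 3K1, which the
    wheel avoids, so [B] lies in the wheel.  If [A] contains P4 + K1, then the
    blow-up contains neither [A] nor [B], as it has no P4 + K1 and no triangle.  If
    [B] contains the gem, then the complement of the blow-up contains neither. *)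
Lemma hits_all_C5_K1 A B : induced_subgraph A C5_K1 -> hits_all (A, B) ->
  [\/ induced_subgraph A nP4, induced_subgraph B nP4 | sparse_dense A B].
Proof.
move=> A51 [hW5 hC7 hcoC7 hbl hcobl].
have noC5 (F G : sgraph) : iso F nC5 -> hits (F, G) C7 -> hits (F, G) coC7 ->
    induced_subgraph G nP4.
  move=> /iso_sym/iso_induced_trans FC [/FC|GC7] /=.
    decide_not_embeds.
  case=> [/FC|] /=; last exact: induced_C7_coC7.
  decide_not_embeds.
case: (induced_C5_K1 A51) => [AP|AC|PA|Asp]; first by constructor 1.
- by constructor 2; exact: noC5 AC hC7 hcoC7.
- have KA : induced_subgraph n3K1 A by apply: induced_subgraph_trans PA; decide_embeds.
  case: hW5 => /= [/(induced_subgraph_trans KA)|BW].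
    decide_not_embeds.
  case: (induced_W5 BW) => [BP|BC|gB|Bde]; first by constructor 2.
  + by constructor 1; apply: (noC5 _ _ BC); apply/or_comm.
  + by case: hbl => /= [/(induced_subgraph_trans PA)|/(induced_subgraph_trans gB)];
      decide_not_embeds.
  + have KB := dense_K3 Bde.
    by case: hbl => /= [/(induced_subgraph_trans PA)|/(induced_subgraph_trans KB)];
      decide_not_embeds.
have KA := sparse_3K1 Asp.
case: hW5 => /= [/(induced_subgraph_trans KA)|BW].
  decide_not_embeds.
case: (induced_W5 BW) => [BP|BC|gB|Bde]; first by constructor 2.
- by constructor 1; apply: (noC5 _ _ BC); apply/or_comm.
- by case: hcobl => /= [/(induced_subgraph_trans KA)|/(induced_subgraph_trans gB)];
    decide_not_embeds.
- by constructor 3.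
Qed.

Lemma sparse_dense_Omega1 A B X : sparse_dense A B ->
  X = (A, B) \/ X = (B, A) -> Omega1 X.
Proof.
have iC F G H : iso G F -> iso H F -> iso H G.
  by move=> GF HF; exact: iso_trans HF (iso_sym GF).
case=> sp de AB.
have pi_ F G F' G' : iso F F' -> iso G G' -> iso A F' -> iso B G' -> pair_is X F G.
  move=> FF GG AF BG; have AF' := iC _ _ _ FF AF; have BG' := iC _ _ _ GG BG.
  by case: AB => ->; [left|right].
case: sp de => As [] Bs.
- by right; constructor 2; constructor 1; exact: pi_ iso_3K1 iso_K3 As Bs.
- by right; constructor 2; constructor 2; exact: pi_ iso_3K1 iso_Z1 As Bs.
- by right; constructor 2; constructor 3; exact: pi_ iso_3K1 iso_D As Bs.
- by right; constructor 3; constructor 1; exact: pi_ iso_K1_P3 iso_K3 As Bs.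
- by right; constructor 3; constructor 2; exact: pi_ iso_K1_P3 iso_Z1 As Bs.
- by right; constructor 3; constructor 3; exact: pi_ iso_K1_P3 iso_D As Bs.
- by right; constructor 4; left; exact: pi_ iso_2K1_K2 iso_K3 As Bs.
- by right; constructor 4; right; exact: pi_ iso_2K1_K2 iso_Z1 As Bs.
- by left; exact: pi_ iso_2K1_K2 iso_D As Bs.
Qed.

Lemma omega_pairs_necessary X :
  (forall G, free X G -> ~ iso G C5 -> omega_colourable G) -> Omega1 X.
Proof.
move=> HX.
have hit n e : n != 5 -> ~ omega_colourable (nat_graph n e) -> hits X (nat_graph n e).
  move=> n5 bad; apply: nfree_hits => fr; apply/bad/HX => // /iso_card.
  by rewrite !card_ord => /eqP; apply/negP.
have hX : hits_all X.
  split; apply: hit => //; [exact: W5_not_omega_colourable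
    |exact: C7_not_omega_colourable|exact: coC7_not_omega_colourable
    |exact: blowup_not_omega_colourable|exact: co_blowup_not_omega_colourable].
have P4E F : induced_subgraph F nP4 -> induced_subgraph F P4.
  by move=> H; exact: induced_iso_trans H (iso_sym iso_P4).
case: X hX {HX} hit => A B hX hit.
have hX' : hits_all (B, A) by case: hX => ? ? ? ? ?; split; apply/or_comm.
case: (hit 6 C5_K1_rel isT C5_K1_not_omega_colourable) => /= /hits_all_C5_K1 H.
- case: (H B hX) => [AP|BP|t].
  + by right; constructor 1; left; exact: P4E.
  + by right; constructor 1; right; exact: P4E.
  + by apply: sparse_dense_Omega1 t _; left.
- case: (H A hX') => [AP|BP|t].
  + by right; constructor 1; right; exact: P4E.
  + by right; constructor 1; left; exact: P4E.
  + by apply: sparse_dense_Omega1 t _; right.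
Qed.

Lemma perfect_omega_colourable G : perfect G -> omega_colourable G.
Proof. by move=> Gp; exact: perfect_induced_subgraph Gp (induced_subgraph_refl G). Qed.

(** C5 with a further vertex adjacent to the two ends of one edge. *)
Definition C5_ear := nat_graph 6
  (edges [:: (0, 1); (1, 2); (2, 3); (3, 4); (0, 4); (0, 5); (1, 5)]).

Lemma C5_ear_free X : pair_is X twoK1_K2 D -> free X C5_ear.
Proof.
have f1 F : iso F twoK1_K2 -> ~ induced_subgraph F C5_ear.
  move=> FT /(iso_induced_trans (iso_sym (iso_trans FT iso_2K1_K2))).
  decide_embeds.
have f2 F : iso F D -> ~ induced_subgraph F C5_ear.
  move=> FT /(iso_induced_trans (iso_sym (iso_trans FT iso_D))).
  decide_embeds.
by case=> -[FX FY]; split; [exact: f1|exact: f2|exact: f2|exact: f1].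
Qed.

Lemma C5_ear_imperfect : ~ perfect C5_ear.
Proof.
move=> /perfect_induced_subgraph H; apply: C5_not_omega_colourable; apply: H.
decide_embeds.
Qed.

Lemma perfect_pairs_necessary X :
  (forall G, free X G -> ~ iso G C5 -> perfect G) -> calP1 X.
Proof.
move=> HX; have [XD|//] : Omega1 X.
  by apply: omega_pairs_necessary => G fr n5; exact/perfect_omega_colourable/HX.
exfalso; apply: C5_ear_imperfect; apply: HX; first exact: C5_ear_free.
by move/iso_card; rewrite !card_ord.
Qed.

(** * Four-vertex patterns and graphs without induced P4 *)

Section Patterns.
Variable G : sgraph.

Lemma adj_neq (x y : G) : adj x y -> x != y.
Proof. by apply: contraTneq => ->; rewrite adj_irrefl. Qed.

Lemma adj_neq_nonadj (x y z : G) : adj x z -> ~~ adj y z -> x != y.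
Proof. by move=> xz; apply: contraNneq => <-. Qed.

(** The paw is Z1 and the diamond is D; their complements are K1 + P3 and
    2K1 + K2.  Distinctness is demanded only of the vertices that the adjacencies
    do not already separate. *)
Definition paw (a b c d : G) : bool :=
  [&& adj a b, adj b c, adj a c, adj a d, ~~ adj b d & ~~ adj c d].
Definition diamond (a b c d : G) : bool :=
  [&& adj a b, adj a c, adj b c, adj a d, adj b d, ~~ adj c d & c != d].
Definition copaw (a b c d : G) : bool :=
  [&& adj a b, adj b c, ~~ adj a c, a != c, ~~ adj a d, ~~ adj b d & ~~ adj c d].
Definition codiamond (a b c d : G) : bool :=
  [&& adj a b, ~~ adj a c, ~~ adj a d, ~~ adj b c, ~~ adj b d, ~~ adj c d & c != d].

Lemma four_vertices (e : rel nat) (a b c d : G) :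
  [&& a != b, a != c, a != d, b != c, b != d & c != d] ->
  [&& adj a b == sym_adj e 0 1, adj a c == sym_adj e 0 2, adj a d == sym_adj e 0 3,
      adj b c == sym_adj e 1 2, adj b d == sym_adj e 1 3 & adj c d == sym_adj e 2 3] ->
  induced_subgraph (nat_graph 4 e) G.
Proof.
move=> /and5P[ab ac ad bc /andP[bd cd]] /and5P[Eab Eac Ead Ebc /andP[Ebd Ecd]].
apply: (@nat_graph_embedding _ _ _ (nth a [:: a; b; c; d])) => i j.
by move: i j => [|[|[|[|i]]]] [|[|[|[|j]]]] // _ _; apply/andP; split.
Qed.

Lemma paw_induced a b c d : paw a b c d -> induced_subgraph Z1 G.
Proof.
case/and5P=> ab bc ac ad /andP[nbd ncd].
have cb : adj c b by rewrite adj_sym.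
apply: iso_induced_trans iso_Z1 _; apply: (@four_vertices _ a b c d).
  rewrite (adj_neq ab) (adj_neq ac) (adj_neq ad) (adj_neq bc).
  by rewrite (adj_neq_nonadj bc) 1?adj_sym // (adj_neq_nonadj cb) 1?adj_sym.
by rewrite ab bc ac ad (negbTE nbd) (negbTE ncd).
Qed.

Lemma diamond_induced a b c d : diamond a b c d -> induced_subgraph D G.
Proof.
case/and5P=> ab ac bc ad /and3P[bd ncd cd].
apply: iso_induced_trans iso_D _; apply: (@four_vertices _ a b c d).
  by rewrite (adj_neq ab) (adj_neq ac) (adj_neq ad) (adj_neq bc) (adj_neq bd).
by rewrite ab bc ac ad bd (negbTE ncd).
Qed.

Lemma copaw_induced a b c d : copaw a b c d -> induced_subgraph K1_P3 G.
Proof.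
case/and5P=> ab bc nac ac /and3P[nad nbd ncd].
have ba : adj b a by rewrite adj_sym.
have cb : adj c b by rewrite adj_sym.
apply: iso_induced_trans iso_K1_P3 _; apply: (@four_vertices _ a b c d).
  rewrite ac (adj_neq ab) (adj_neq bc) (adj_neq_nonadj ab) 1?adj_sym //.
  by rewrite (adj_neq_nonadj ba) 1?adj_sym // (adj_neq_nonadj cb) 1?adj_sym.
by rewrite ab bc (negbTE nac) (negbTE nad) (negbTE nbd) (negbTE ncd).
Qed.

Lemma codiamond_induced a b c d : codiamond a b c d -> induced_subgraph twoK1_K2 G.
Proof.
case/and5P=> ab nac nad nbc /and3P[nbd ncd cd].
have ba : adj b a by rewrite adj_sym.
apply: iso_induced_trans iso_2K1_K2 _; apply: (@four_vertices _ a b c d).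
  rewrite cd (adj_neq ab) (adj_neq_nonadj ab) 1?adj_sym //.
  rewrite (adj_neq_nonadj ab) 1?adj_sym // (adj_neq_nonadj ba) 1?adj_sym //.
  by rewrite (adj_neq_nonadj ba) 1?adj_sym.
by rewrite ab !(negbTE nac, negbTE nad, negbTE nbc, negbTE nbd, negbTE ncd).
Qed.

Definition path4 (a b c d : G) : bool :=
  [&& adj a b, adj b c, adj c d, ~~ adj a c, ~~ adj a d & ~~ adj b d].

Lemma path4_neq a b c d : path4 a b c d ->
  [&& a != b, a != c, a != d, b != c, b != d & c != d].
Proof.
case/and5P=> ab bc cd nac /andP[nad nbd].
have ba : adj b a by rewrite adj_sym.
rewrite (adj_neq ab) (adj_neq bc) (adj_neq cd) (eq_sym a c) (adj_neq_nonadj cd) //.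
by rewrite (adj_neq_nonadj ab) 1?adj_sym // (adj_neq_nonadj ba) 1?adj_sym.
Qed.

Lemma path4_induced a b c d : path4 a b c d -> induced_subgraph P4 G.
Proof.
move=> Pabcd; apply: iso_induced_trans iso_P4 _.
apply: (four_vertices (path4_neq Pabcd)).
by case/and5P: Pabcd => -> -> -> /negbTE-> /andP[/negbTE-> /negbTE->].
Qed.

Lemma induced_path4 : induced_subgraph P4 G -> exists a b c d, path4 a b c d.
Proof.
move/(iso_induced_trans (iso_sym iso_P4))/induced_subgraphP=> [f [_ fE]].
pose v i := f (inord i : 'I_4); exists (v 0), (v 1), (v 2), (v 3).
by rewrite /path4 /v !fE /= /nat_adj !inordK.
Qed.

End Patterns.

Section PathHitting.
Variable G : sgraph.

Definition stableb (I : {set G}) : bool := [forall x in I, forall y in I, ~~ adj x y].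

Lemma stablebP (I : {set G}) : reflect (stable I) (stableb I).
Proof.
apply: (iffP forall_inP) => [SP x y xI yI|SP x xI].
  by move: (SP x xI) => /forall_inP/(_ y yI).
by apply/forall_inP=> y yI; exact: SP.
Qed.

Lemma max_stable_ex : exists2 I : {set G}, stable I &
  forall J : {set G}, stable J -> #|J| <= #|I|.
Proof.
have st0 : stableb set0 by apply/stablebP=> x y; rewrite inE.
case: (arg_maxnP (fun I : {set G} => #|I|) st0) => I /stablebP Ist Imax.
by exists I => // J /stablebP; exact: Imax.
Qed.

Lemma max_stable_dominates (I : {set G}) (x : G) : stable I ->
  (forall J : {set G}, stable J -> #|J| <= #|I|) ->
  x \notin I -> exists2 y, y \in I & adj x y.
Proof.
move=> Ist Imax xI; apply/exists_inP; apply: contraT => /exists_inPn nadj.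
have := Imax (x |: I); rewrite cardsU1 xI ltnn => H; apply: H => y z.
rewrite !inE => /predU1P[->|yI] /predU1P[->|zI].
- by rewrite adj_irrefl.
- exact: nadj.
- by rewrite adj_sym nadj.
- exact: Ist.
Qed.

(** A maximum stable set [I] meets every inclusion-maximal clique [K].  If it
    did not, take [s] in [I] with the most neighbours in [K], then [k] in [K] not
    adjacent to [s], and [t] in [I] adjacent to [k].  By the choice of [s] some
    [m] in [K] is adjacent to [s] and not to [t], and [s m k t] is an induced P4. *)
Lemma P4_free_hitting : ~ induced_subgraph P4 G -> 0 < #|G| ->
  exists2 I : {set G}, stable I & hits_max_cliques I.
Proof.
move=> noP Gpos.
have [I Ist Imax] := max_stable_ex; exists I => // K Kc KI.
have [/existsP[x /forall_inP xK]|/existsPn no_ext] :=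
    boolP [exists x, [forall y in K, adj x y]].
  exists (x |: K); last first.
    have nxK : x \notin K by apply/negP=> /xK; rewrite adj_irrefl.
    by rewrite cardsU1 nxK.
  apply/cliqueP=> y z; rewrite !inE => /predU1P[->|yK] /predU1P[->|zK].
  - by rewrite eqxx.
  - by move=> _; exact: xK.
  - by move=> _; rewrite adj_sym; exact: xK.
  - exact: (cliqueP _ Kc).
exfalso; have [s0 s0I] : exists s, s \in I.
  case/card_gt0P: Gpos => x _; case: (boolP (x \in I)) => [|xI]; first by exists x.
  by have [y yI _] := max_stable_dominates Ist Imax xI; exists y.
pose nb s := [set k in K | adj s k].
case: (arg_maxnP (fun s => #|nb s|) s0I) => s sI smax.
have [k kK nsk] : exists2 k, k \in K & ~~ adj s k.
  by apply/exists_inP; rewrite -negb_forall_in; exact: no_ext.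
have kI : k \notin I by rewrite (disjointFr KI).
have [t tI kt] := max_stable_dominates Ist Imax kI.
have /subsetPn[m] : ~~ (nb s \subset nb t).
  apply/negP=> sub; have : nb s \proper nb t.
    by rewrite properE sub; apply/subsetPn; exists k;
      rewrite !inE kK ?(adj_sym t) // negb_and nsk orbT.
  by move/proper_card; rewrite ltnNge (smax t tI : #|nb t| <= #|nb s|).
rewrite !inE => /andP[mK sm]; rewrite mK /= => ntm.
have mk : adj m k by apply: (cliqueP _ Kc) => //; apply: contraNneq nsk => <-.
apply: noP; apply: (@path4_induced _ s m k t).
by rewrite /path4 sm mk kt nsk (Ist s t) // (adj_sym m) ntm.
Qed.

(** Cliques avoiding one side of a bipartition have at most one vertex, and the
    edge provides a clique with two. *)
Lemma bipartition_hits (I : {set G}) (x y : G) :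
  stable (~: I) -> adj x y -> hits_max_cliques I.
Proof.
move=> cst xy K /cliqueP Kc KI; exists [set x; y].
  apply/cliqueP=> u v; rewrite !inE => /orP[]/eqP-> /orP[]/eqP->; rewrite ?eqxx //.
  by rewrite adj_sym.
rewrite cards2 adj_neq // ltnS; apply/card_le1_eqP=> u v uK vK.
apply/eqP; apply: contraT => uv; have := Kc v u vK uK uv; apply/contraTT => _.
by apply: cst; rewrite inE (disjointFr KI).
Qed.
End PathHitting.

Lemma P4_free_perfect G : ~ induced_subgraph P4 G -> perfect G.
Proof.
move=> noP; apply: perfect_hitting => H HG Hpos.
by apply: P4_free_hitting Hpos => P4H; exact/noP/(induced_subgraph_trans P4H).
Qed.

(** * How a vertex sees an induced P4 *)

Section Types.
Variable G : sgraph.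

(** [typ] bounds the possible adjacencies of an outer vertex to the consecutive
    vertices of an induced P4. *)
Definition trace (typ : bool -> bool -> bool -> bool -> bool) : Prop :=
  forall a b c d v : G, path4 a b c d -> v \notin [:: a; b; c; d] ->
  typ (adj v a) (adj v b) (adj v c) (adj v d).

(** The adjacencies that turn the P4 into a C5. *)
Definition ends (x1 x2 x3 x4 : bool) := [&& x1, ~~ x2, ~~ x3 & x4].

(** Adjacent to both ends of one outer edge of the P4, and not to the nearer end
    of the other. *)
Definition cobip_trace (x1 x2 x3 x4 : bool) :=
  [&& x1, x2 & ~~ x3] || [&& ~~ x2, x3 & x4].

(** Adjacent to one end of the P4, and to no vertex in the colour class of the
    other end in the bipartition of the P4. *)
Definition bip_trace (x1 x2 x3 x4 : bool) :=
  (x1 && ~~ (x2 || x4)) || (x4 && ~~ (x1 || x3)).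

(** The goal is expected to start with the instances of the excluded patterns that
    rule out neighbourhoods; what remains is a tautology in the four adjacencies
    of [v]. *)
Ltac trace_by_cases a b c d v P vP :=
  move: vP (path4_neq P); rewrite !inE !negb_or;
  rewrite /paw /diamond /copaw /codiamond !(adj_sym _ v) !(eq_sym _ v);
  case/and4P=> ? ? ? ? /and5P[_ ? _ _ /andP[? _]];
  repeat match goal with H : is_true (_ != _) |- _ => rewrite ?H; clear H end;
  rewrite ?(adj_sym b a) ?(adj_sym c a) ?(adj_sym d a);
  rewrite ?(adj_sym c b) ?(adj_sym d b) ?(adj_sym d c);
  case/and5P: P => -> -> -> /negbTE-> /andP[/negbTE-> /negbTE->];
  by case: (adj v a); case: (adj v b); case: (adj v c); case: (adj v d).

Lemma trace_paw_copaw :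
  ~ induced_subgraph Z1 G -> ~ induced_subgraph K1_P3 G -> trace ends.
Proof.
move=> noP noC a b c d v P vP.
have nP (w x y z : G) : paw w x y z = false.
  by apply/negbTE/negP=> H; apply: noP (paw_induced H).
have nC (w x y z : G) : copaw w x y z = false.
  by apply/negbTE/negP=> H; apply: noC (copaw_induced H).
move: (nP b a v c) (nP c b v d) (nP b c v a) (nP c d v b) (nP v a b d).
move: (nC a b c v) (nC b c d v) (nC a b v d) (nC v c d a) (nC v a b d) (nC v d c a).
trace_by_cases a b c d v P vP.
Qed.

Lemma trace_diamond_copaw :
  ~ induced_subgraph D G -> ~ induced_subgraph K1_P3 G ->
  trace (fun x1 x2 x3 x4 => ends x1 x2 x3 x4 || cobip_trace x1 x2 x3 x4).
Proof.
move=> noP noC a b c d v P vP.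
have nP (w x y z : G) : diamond w x y z = false.
  by apply/negbTE/negP=> H; apply: noP (diamond_induced H).
have nC (w x y z : G) : copaw w x y z = false.
  by apply/negbTE/negP=> H; apply: noC (copaw_induced H).
move: (nP b v a c) (nP c v b d).
move: (nC a b c v) (nC b c d v) (nC a b v d) (nC v c d a) (nC v a b d) (nC v d c a).
trace_by_cases a b c d v P vP.
Qed.

Lemma trace_paw_codiamond :
  ~ induced_subgraph Z1 G -> ~ induced_subgraph twoK1_K2 G ->
  trace (fun x1 x2 x3 x4 => ends x1 x2 x3 x4 || bip_trace x1 x2 x3 x4).
Proof.
move=> noP noC a b c d v P vP.
have nP (w x y z : G) : paw w x y z = false.
  by apply/negbTE/negP=> H; apply: noP (paw_induced H).
have nC (w x y z : G) : codiamond w x y z = false.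
  by apply/negbTE/negP=> H; apply: noC (codiamond_induced H).
move: (nP b a v c) (nP c b v d) (nP b c v a) (nP c d v b) (nP v a b d).
move: (nC a b d v) (nC c d a v).
trace_by_cases a b c d v P vP.
Qed.

(** An outer vertex of an induced C5 would have to obey [typ] on each of the five
    induced P4s of the C5, and the first hypothesis says that this is impossible. *)
Lemma C5_iso (typ : bool -> bool -> bool -> bool -> bool) :
  (forall x1 x2 x3 x4 x5, ~~ [&& typ x1 x2 x3 x4, typ x2 x3 x4 x5, typ x3 x4 x5 x1,
     typ x4 x5 x1 x2 & typ x5 x1 x2 x3]) ->
  trace typ -> induced_subgraph C5 G -> iso G C5.
Proof.
move=> typ0 typG C5G; apply: iso_sym; apply: induced_subgraph_iso (C5G) _.
case/induced_subgraphP: C5G => f [f_inj fE].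
rewrite -(card_codom f_inj); apply/subset_leq_card/subsetP=> v _; apply: contraT => vf.
pose i0 := @Ordinal 5 0 isT; pose i1 := @Ordinal 5 1 isT; pose i2 := @Ordinal 5 2 isT.
pose i3 := @Ordinal 5 3 isT; pose i4 := @Ordinal 5 4 isT.
have tr (i j k l : 'I_5) : @path4 C5 i j k l ->
    typ (adj v (f i)) (adj v (f j)) (adj v (f k)) (adj v (f l)).
  move=> Pijkl; apply: typG; first by rewrite /path4 !fE.
  by apply: contra vf; rewrite !inE => /or4P[]/eqP->; exact: codom_f.
have := typ0 (adj v (f i0)) (adj v (f i1)) (adj v (f i2)) (adj v (f i3)) (adj v (f i4)).
by rewrite !tr.
Qed.

Lemma path4_ends_C5 (a b c d v : G) : path4 a b c d ->
  ends (adj v a) (adj v b) (adj v c) (adj v d) -> induced_subgraph C5 G.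
Proof.
move=> Pabcd /and4P[va vb vc vd]; apply: iso_induced_trans iso_C5 _.
have /and5P[ab ac ad bc /andP[bd cd]] := path4_neq Pabcd.
have /and5P[Eab Ebc Ecd /negbTE Eac /andP[/negbTE Ead /negbTE Ebd]] := Pabcd.
have nav : a != v by rewrite eq_sym adj_neq.
have ndv : d != v by rewrite eq_sym adj_neq.
have nbv : b != v by apply: contraNneq vc => <-.
have ncv : c != v by apply: contraNneq vb => <-; rewrite adj_sym.
move: va vb vc vd; rewrite !(adj_sym v) => Eav /negbTE Ebv /negbTE Ecv Edv.
apply: (@nat_graph_embedding _ _ _ (nth a [:: a; b; c; d; v])) => i j.
by move: i j => [|[|[|[|[|i]]]]] [|[|[|[|[|j]]]]] // _ _; rewrite /=
  ?(ab, ac, ad, bc, bd, cd, nav, nbv, ncv, ndv)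
  ?(Eab, Eac, Ead, Ebc, Ebd, Ecd, Eav, Ebv, Ecv, Edv).
Qed.

End Types.

(** * The three perfect classes *)

(** The common scheme for the three classes.  The C5 windows first exclude an
    induced C5; then [ends] no longer occurs, and only induced subgraphs with a P4
    whose outer vertices obey [typ] need a stable set. *)
Lemma perfect_by_traces (A B : sgraph) (typ : bool -> bool -> bool -> bool -> bool) :
  (forall H, ~ induced_subgraph A H -> ~ induced_subgraph B H ->
     @trace H (fun x1 x2 x3 x4 => ends x1 x2 x3 x4 || typ x1 x2 x3 x4)) ->
  (forall x1 x2 x3 x4 x5,
     let t y1 y2 y3 y4 := ends y1 y2 y3 y4 || typ y1 y2 y3 y4 in
     ~~ [&& t x1 x2 x3 x4, t x2 x3 x4 x5, t x3 x4 x5 x1,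
            t x4 x5 x1 x2 & t x5 x1 x2 x3]) ->
  (forall (H : sgraph) (a b c d : H),
     ~ induced_subgraph A H -> ~ induced_subgraph B H ->
     path4 a b c d -> @trace H typ ->
     exists2 I : {set H}, stable I & hits_max_cliques I) ->
  forall G, ~ induced_subgraph A G -> ~ induced_subgraph B G -> ~ iso G C5 ->
  perfect G.
Proof.
move=> AB_trace windows AB_hits G noA noB notC5.
have noC5 : ~ induced_subgraph C5 G.
  by move=> C5G; apply: notC5; exact: C5_iso windows (AB_trace _ noA noB) C5G.
apply: perfect_hitting => H HG Hpos.
have hered F : ~ induced_subgraph F G -> ~ induced_subgraph F H.
  by move=> noF FH; exact/noF/(induced_subgraph_trans FH).
case: (induced_subgraph_em P4 H) => [/induced_path4[a [b [c [d P]]]]|noP4]; last first.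
  exact: P4_free_hitting.
apply: (AB_hits H a b c d) => //; try exact: hered.
move=> a' b' c' d' v P' vP'.
case/orP: (AB_trace H (hered _ noA) (hered _ noB) _ _ _ _ _ P' vP') => //.
by move/(path4_ends_C5 P')/hered.
Qed.

Lemma perfect_paw_copaw G : ~ induced_subgraph Z1 G -> ~ induced_subgraph K1_P3 G ->
  ~ iso G C5 -> perfect G.
Proof.
apply: (@perfect_by_traces _ _ (fun _ _ _ _ => false)) => [H noZ noC|x1 x2 x3 x4 x5|].
- by move=> a b c d v P vP; rewrite orbF; exact: trace_paw_copaw P vP.
- by case: x1; case: x2; case: x3; case: x4; case: x5.
(* No outer vertex is possible, so the induced subgraph is the P4 itself. *)
move=> H a b c d _ _ P no_other.
have VP v : v \in [:: a; b; c; d].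
  by apply: contraT => vP; have := no_other _ _ _ _ _ P vP.
have /and5P[ab bc cd ac /andP[ad bd]] := P.
have ends_stable (x y : H) : ~~ adj x y -> stable [set x; y].
  by move=> nxy u v; rewrite !inE => /orP[]/eqP-> /orP[]/eqP->;
    rewrite ?adj_irrefl // adj_sym.
exists [set a; c]; first exact: ends_stable.
apply: bipartition_hits ab => u v uI vI; apply: (ends_stable b d bd).
  by move: (VP u) uI; rewrite !inE => /or4P[] ->; rewrite ?orbT /=.
by move: (VP v) vI; rewrite !inE => /or4P[] ->; rewrite ?orbT /=.
Qed.

Lemma path4_rev (G : sgraph) (a b c d : G) : path4 a b c d -> path4 d c b a.
Proof.
rewrite /path4 (adj_sym d c) (adj_sym c b) (adj_sym b a) (adj_sym d b) (adj_sym d a).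
by rewrite (adj_sym c a) => /and5P[-> -> -> -> /andP[-> ->]].
Qed.

Lemma nbhd_end (G : sgraph) (a b c d x : G) : path4 a b c d -> @trace G bip_trace ->
  adj x d -> ~~ adj x a /\ ((x == c) || ~~ adj x c).
Proof.
move=> P bip xd; have /and5P[ab bc cd ac /andP[ad bd]] := P.
have [xP|xP] := boolP (x \in [:: a; b; c; d]).
  move: xP; rewrite !inE => /or4P[]/eqP xE; rewrite {x}xE ?adj_irrefl in xd *.
  - by rewrite xd in ad.
  - by rewrite xd in bd.
  - by rewrite eqxx adj_sym.
  - by [].
have := bip _ _ _ _ _ P xP; rewrite /bip_trace xd orbT andbF /=.
by rewrite negb_or => /andP[-> ->]; rewrite orbT.
Qed.

(** Two adjacent neighbours of [d] other than [c] would form with [d] a triangle to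
    which [c] is attached at [d] only, that is, a paw. *)
Lemma nbhd_end_stable (G : sgraph) (a b c d : G) : ~ induced_subgraph Z1 G ->
  path4 a b c d -> @trace G bip_trace -> stable [set x | (x == a) || adj x d].
Proof.
move=> noZ P bip x y; rewrite !inE.
have /and5P[_ _ cd _ _] := P.
case/predU1P=> [->|xd] /predU1P[->|yd]; rewrite ?adj_irrefl //.
- by rewrite adj_sym; case: (nbhd_end P bip yd).
- by case: (nbhd_end P bip xd).
case: (nbhd_end P bip xd) (nbhd_end P bip yd) => _ /predU1P[->|xc] [_ /predU1P[->|yc]].
- by rewrite adj_irrefl.
- by rewrite adj_sym.
- by [].
apply/negP=> xy; apply: noZ; apply: (@paw_induced _ d x y c).
by rewrite /paw xy xc yc !(adj_sym d) xd yd cd.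
Qed.

(** Every vertex other than [a] and [d] is adjacent to exactly one of them, and
    [nbhd_end_stable] applied to the P4 and to its reversal shows that the two
    classes are stable. *)
Lemma perfect_paw_codiamond G :
  ~ induced_subgraph Z1 G -> ~ induced_subgraph twoK1_K2 G -> ~ iso G C5 -> perfect G.
Proof.
apply: (perfect_by_traces (typ := bip_trace) trace_paw_codiamond)
  => [x1 x2 x3 x4 x5|H a b c d noZ _ P bip].
  by case: x1; case: x2; case: x3; case: x4; case: x5.
exists [set x | (x == a) || adj x d]; first exact: nbhd_end_stable P bip.
have /and5P[ab _ _ _ _] := P.
apply: bipartition_hits ab => x y xI yI.
have sub z : z \in ~: [set x | (x == a) || adj x d] -> z \in [set x | (x == d) || adj x a].
  rewrite !inE negb_or => /andP[za zd]; have [zP|zP] := boolP (z \in [:: a; b; c; d]).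
    move: zP zd za; rewrite !inE => /or4P[]/eqP->; rewrite ?eqxx //.
    - by rewrite (adj_sym b a) => _ _; case/and5P: P => ->; rewrite orbT.
    - by case/and5P: P => _ _ ->.
  have := bip _ _ _ _ _ P zP; rewrite /bip_trace (negbTE zd) /= !orbF.
  by case/andP=> -> _; rewrite orbT.
exact: (nbhd_end_stable noZ (path4_rev P) bip (sub x xI) (sub y yI)).
Qed.

Section Cobipartite.
Variable G : sgraph.
Hypotheses (noD : ~ induced_subgraph D G) (cobip : @trace G cobip_trace).

Definition edge_clique (u v : G) : {set G} :=
  [set x | [|| x == u, x == v | adj x u && adj x v]].

Lemma edge_cliqueC u v : edge_clique u v = edge_clique v u.
Proof. by apply/setP=> x; rewrite !inE orbCA andbC. Qed.

Lemma edge_clique_clique u v : adj u v -> clique (edge_clique u v).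
Proof.
move=> uv; apply/cliqueP=> x y; rewrite !inE.
case/or3P=> [/eqP->|/eqP->|/andP[xu xv]] /or3P[/eqP->|/eqP->|/andP[yu yv]] xy;
  rewrite ?eqxx in xy *; rewrite // adj_sym //.
apply: contraT => nxy; case: noD; apply: (@diamond_induced _ u v y x).
by rewrite /diamond uv !(adj_sym u) !(adj_sym v) xu xv yu yv nxy eq_sym.
Qed.

Lemma edge_clique_cover a b c d x : path4 a b c d ->
  (x \in edge_clique a b) || (x \in edge_clique c d).
Proof.
move=> P; rewrite !inE; have [|xP] := boolP (x \in [:: a; b; c; d]).
  by rewrite !inE => /or4P[]->; rewrite ?orbT.
by case/orP: (cobip P xP) => [/and3P[-> -> _]|/and3P[_ -> ->]]; rewrite ?orbT.
Qed.

(** Otherwise [x], [y] and [z] form a triangle.  As [x] is not adjacent to all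
    of the clique of [c d], a further vertex [w] of it completes a diamond on the
    edge [y z]. *)
Lemma edge_clique_cross a b c d x y z : path4 a b c d ->
  x \in edge_clique a b -> y \in edge_clique c d -> z \in edge_clique c d ->
  adj x y -> adj x z -> y = z.
Proof.
move=> P xQ yQ zQ xy xz; apply/eqP; apply: contraT => yz; case: noD.
have /and5P[ab bc cd ac /andP[ad bd]] := P.
have QP := cliqueP _ (edge_clique_clique cd).
have /and5P[_ nac nad nbc /andP[nbd _]] := path4_neq P.
have [w wQ /andP[xw x_w]] :
    exists2 w, w \in edge_clique c d & ~~ adj x w && (x != w).
  have [->|xb] := eqVneq x b; first by exists d; rewrite ?inE ?eqxx ?orbT ?bd.
  exists c; first by rewrite !inE eqxx.
  move: xQ; rewrite inE (negbTE xb) /=.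
  case/predU1P=> [->|/andP[xa xb']]; first by rewrite ac.
  have [xP|xP] := boolP (x \in [:: a; b; c; d]).
    move: xP; rewrite !inE (negbTE xb) /= => /or3P[]/eqP xE; move: xa.
    - by rewrite xE adj_irrefl.
    - by rewrite xE adj_sym (negbTE ac).
    - by rewrite xE adj_sym (negbTE ad).
  have := cobip P xP; rewrite /cobip_trace xa xb' /= orbF => ->.
  by move: xP; rewrite !inE !negb_or => /and4P[].
have neq u : adj x u -> u != w by apply: contraTneq => ->.
apply: (@diamond_induced _ y z x w).
by rewrite /diamond !(adj_sym _ x) xy xz xw x_w (QP y z) // (QP y w) ?(QP z w) ?neq.
Qed.

(** The cliques of [a b] and [c d] cover the graph and are joined by a matching.
    The stable set [{a, c}] meets both of them.  A clique avoiding it and contained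
    in neither has one vertex in each; it is beaten by one of the two cliques,
    unless both have two vertices, in which case it would be [{b, d}], not an edge. *)
Lemma cobip_hits (a b c d : G) : path4 a b c d ->
  exists2 I : {set G}, stable I & hits_max_cliques I.
Proof.
move=> P; have /and5P[ab bc cd ac /andP[ad bd]] := P.
have /and5P[nab nac nad nbc /andP[nbd ncd]] := path4_neq P.
exists [set a; c].
  move=> x y; rewrite !inE => /orP[]/eqP-> /orP[]/eqP->; rewrite ?adj_irrefl //.
  by rewrite adj_sym.
move=> K Kc KI; have KP := cliqueP _ Kc.
have aK : a \notin K by rewrite (disjointFl KI) // !inE eqxx.
have cK : c \notin K by rewrite (disjointFl KI) // !inE eqxx orbT.
have larger (Q : {set G}) u : clique Q -> u \in Q -> u \notin K -> K \subset Q ->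
    exists2 L : {set G}, clique L & #|K| < #|L|.
  move=> Qc uQ uK KQ; exists Q => //; apply: proper_card; rewrite properE KQ.
  by apply/subsetPn; exists u.
have abQ := edge_clique_clique ab; have cdQ := edge_clique_clique cd.
have [KQ|/subsetPn[x xK xQ]] := boolP (K \subset edge_clique a b).
  by apply: (larger _ a _ _ _ KQ) => //; rewrite !inE eqxx.
have [KQ|/subsetPn[y yK yQ]] := boolP (K \subset edge_clique c d).
  by apply: (larger _ c _ _ _ KQ) => //; rewrite !inE eqxx.
have xQ' : x \in edge_clique c d by have := edge_clique_cover x P; rewrite (negbTE xQ).
have yQ' : y \in edge_clique a b.
  by have := edge_clique_cover y P; rewrite (negbTE yQ) orbF.
have K_xy : K \subset [set x; y].
  apply/subsetP=> z zK; rewrite !inE.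
  have [//|zx] := eqVneq z x; have [//|zy] /= := eqVneq z y.
  have xy : x != y by apply: contraNneq xQ => ->.
  have yx : adj y x by apply: KP => //; rewrite eq_sym.
  have yz : adj y z by apply: KP => //; rewrite eq_sym.
  have xz : adj x z by apply: KP => //; rewrite eq_sym.
  case/orP: (edge_clique_cover z P) => zQ.
    have xQd : x \in edge_clique d c by rewrite edge_cliqueC.
    rewrite edge_cliqueC in yQ'; rewrite edge_cliqueC in zQ.
    rewrite (edge_clique_cross (path4_rev P) xQd yQ' zQ) ?eqxx // in zy.
    by rewrite adj_sym.
  by rewrite (edge_clique_cross P yQ' xQ' zQ yx yz) eqxx in zx.
have K2 : #|K| <= 2 by rewrite (leq_trans (subset_leq_card K_xy)) // cards2; case: (x != y).
have [xd|xd] := eqVneq x d; last first.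
  exists (edge_clique c d) => //; apply: leq_ltn_trans K2 _.
  have xc : x != c by apply: contraNneq cK => <-.
  apply: (@leq_trans #|[set c; d; x]|).
    by rewrite setUC cardsU1 cards2 ncd !inE negb_or xc xd.
  by apply/subset_leq_card/subsetP=> u; rewrite !inE => /orP[/orP[]|]/eqP->;
    rewrite ?eqxx ?orbT //; move: xQ'; rewrite !inE.
have [yb|yb] := eqVneq y b; last first.
  exists (edge_clique a b) => //; apply: leq_ltn_trans K2 _.
  have ya : y != a by apply: contraNneq aK => <-.
  apply: (@leq_trans #|[set a; b; y]|).
    by rewrite setUC cardsU1 cards2 nab !inE negb_or ya yb.
  by apply/subset_leq_card/subsetP=> u; rewrite !inE => /orP[/orP[]|]/eqP->;
    rewrite ?eqxx ?orbT //; move: yQ'; rewrite !inE.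
by have := KP y x yK xK; rewrite yb xd (negbTE bd) nbd => /(_ isT).
Qed.
End Cobipartite.

Lemma perfect_diamond_copaw G :
  ~ induced_subgraph D G -> ~ induced_subgraph K1_P3 G -> ~ iso G C5 -> perfect G.
Proof.
apply: (perfect_by_traces (typ := cobip_trace) trace_diamond_copaw)
  => [x1 x2 x3 x4 x5|H a b c d noD _ P cobip].
  by case: x1; case: x2; case: x3; case: x4; case: x5.
exact: (cobip_hits noD cobip P).
Qed.

(** * Graphs without the diamond and its complement *)

Section ThreeColours.
Variable G : sgraph.
Hypotheses (noD : ~ induced_subgraph D G) (noC : ~ induced_subgraph twoK1_K2 G).
Variable I : {set G}.
Hypotheses (Ist : stable I) (Imax : forall J : {set G}, stable J -> #|J| <= #|I|).
Hypothesis I3 : 3 <= #|I|.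

Definition missed (u : G) : {set G} := [set s in I | ~~ adj u s].

(** By maximality [u] has a neighbour in [I]; with two missed vertices this edge
    would form 2K1 + K2. *)
Lemma missed_le1 u : u \notin I -> #|missed u| <= 1.
Proof.
move=> uI; have [w wI uw] := max_stable_dominates Ist Imax uI.
apply/card_le1_eqP=> s t; rewrite !inE => /andP[sI us] /andP[tI ut].
apply/eqP; apply: contraT => st; case: noC; apply: (@codiamond_induced _ u w t s).
by rewrite /codiamond uw us ut (Ist wI sI) (Ist wI tI) (Ist tI sI).
Qed.

(** Two common neighbours in [I] of adjacent outer vertices would give a diamond,
    so all but one vertex of [I] are missed by one of the two.  As each misses at
    most one and [I] has at least three vertices, all the bounds are attained. *)
Lemma missed_edge u v : u \notin I -> v \notin I -> adj u v ->
  #|I| = 3 /\ exists p q, [/\ missed u = [set p], missed v = [set q],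
    p \in I, q \in I & p != q].
Proof.
move=> uI vI uv.
have common : #|I :\: (missed u :|: missed v)| <= 1.
  apply/card_le1_eqP=> s t.
  rewrite !inE !negb_or !negb_and !negbK => /andP[/andP[us vs] sI] /andP[/andP[ut vt] tI].
  rewrite sI /= in us vs; rewrite tI /= in ut vt.
  apply/eqP; apply: contraT => st; case: noD; apply: (@diamond_induced _ u v t s).
  by rewrite /diamond uv us vs ut vt Ist.
have sub : missed u :|: missed v \subset I.
  by apply/subsetP=> s; rewrite !inE => /orP[]/andP[].
have I_le : #|I| <= #|missed u :|: missed v| + 1.
  by rewrite -(cardsID (missed u :|: missed v) I) (setIidPr sub) leq_add2l.
have U2 : 1 < #|missed u :|: missed v|.
  by have := leq_trans I3 I_le; rewrite addn1 ltnS.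
have Ule : #|missed u :|: missed v| <= #|missed u| + #|missed v|.
  by rewrite -cardsUI leq_addr.
have u1 := missed_le1 uI; have v1 := missed_le1 vI.
have Mu : #|missed u| == 1.
  rewrite eqn_leq u1 -(leq_add2r 1); apply: leq_trans U2 (leq_trans Ule _).
  by rewrite leq_add2l.
have Mv : #|missed v| == 1.
  rewrite eqn_leq v1 -(leq_add2l 1); apply: leq_trans U2 (leq_trans Ule _).
  by rewrite leq_add2r.
split.
  apply/eqP; rewrite eqn_leq I3 andbT (leq_trans I_le) // addn1 ltnS.
  by rewrite (leq_trans Ule) // (eqP Mu) (eqP Mv).
case/cards1P: Mu => p Mp; case/cards1P: Mv => q Mq; exists p, q.
have : p \in missed u by rewrite Mp set11.
have : q \in missed v by rewrite Mq set11.
rewrite !inE => /andP[qI _] /andP[pI _]; split=> //.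
by apply: contraTneq U2 => pq; rewrite Mp Mq pq setUid cards1.
Qed.

Lemma missedP u s : (s \in missed u) = (s \in I) && ~~ adj u s.
Proof. by rewrite inE. Qed.

Lemma colourable3_no_edge : stable (~: I) -> colourable G 3.
Proof.
move=> cst; apply: (@colourable_leq _ 2) => //; apply/colourableP.
exists (fun x => x \notin I : nat) => [x|x y xy]; first by case: (_ \in _).
apply: contraTneq xy; case: (boolP (x \in I)) (boolP (y \in I)) => xI [] yI // _.
  exact: Ist.
by apply: cst; rewrite inE.
Qed.

(** The vertex [w] is adjacent to all of [I] and to no outer vertex.  It forces
    outer vertices that miss a vertex of [I] to miss different ones, so at most three
    outer vertices lie on an outer edge; they span no triangle.  With one colour
    for [I], the neighbours of [u] and the other outer vertices form two stable
    classes. *)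
Lemma colourable3_dominating u v w : u \notin I -> v \notin I -> adj u v ->
  w \notin I -> missed w = set0 -> colourable G 3.
Proof.
move=> uI vI uv wI Mw.
have triangle x y z : x \notin I -> y \notin I -> z \notin I ->
    adj x y -> adj x z -> ~~ adj y z.
  move=> xI yI zI xy xz; apply/negP=> yz.
  have [_ [p [q [Mx My _ _ pq]]]] := missed_edge xI yI xy.
  have [_ [p' [r [Mx' Mz _ rI pr]]]] := missed_edge xI zI xz.
  have [_ [q' [r' [My' Mz' _ _ qr]]]] := missed_edge yI zI yz.
  have ep : p' = p by apply: set1_inj; rewrite -Mx' Mx.
  have eq : q' = q by apply: set1_inj; rewrite -My' My.
  have er : r' = r by apply: set1_inj; rewrite -Mz' Mz.
  subst p' q' r'.
  have xr : adj x r by apply: contraT => nxr; have := missedP x r;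
    rewrite Mx inE rI nxr eq_sym (negbTE pr).
  have yr : adj y r by apply: contraT => nyr; have := missedP y r;
    rewrite My inE rI nyr eq_sym (negbTE qr).
  have zr : ~~ adj z r by have := missedP z r; rewrite Mz set11 rI.
  case: noD; apply: (@diamond_induced _ x y z r).
  by rewrite /diamond xy xz yz xr yr zr; apply: contraNneq zI => ->.
have missed_inj x y p : x \notin I -> y \notin I ->
    missed x = [set p] -> missed y = [set p] -> x = y.
  move=> xI yI Mx My; apply/eqP; apply: contraT => xy.
  have w_isol z : z \notin I -> ~~ adj w z.
    move=> zI; apply/negP=> wz; have [_ [p' [q' [M _ _ _ _]]]] := missed_edge wI zI wz.
    by have := set11 p'; rewrite -M Mw inE.
  have /andP[pI xp] : (p \in I) && ~~ adj x p by rewrite -missedP Mx set11.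
  have /andP[_ yp] : (p \in I) && ~~ adj y p by rewrite -missedP My set11.
  have wp : adj w p by apply: contraT => nwp; have := missedP w p; rewrite Mw inE pI nwp.
  have nxy : ~~ adj x y.
    apply/negP=> /(missed_edge xI yI)[_ [p' [q' [Mx' My' _ _]]]].
    by rewrite Mx in Mx'; rewrite My in My'; rewrite -(set1_inj Mx') -(set1_inj My') eqxx.
  case: noC; apply: (@codiamond_induced _ w p x y).
  by rewrite /codiamond wp !w_isol // !(adj_sym p) xp yp nxy xy.
have [cardI [p [q [Mu Mv pI qI pq]]]] := missed_edge uI vI uv.
apply/colourableP.
exists (fun x => if x \in I then 0 else if adj u x then 2 else 1) => [x|x y xy].
  by case: ifP => // _; case: ifP.
case: (boolP (x \in I)) (boolP (y \in I)) => xI [] yI.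
- by have := Ist xI yI; rewrite xy.
- by case: ifP.
- by case: ifP.
case: (boolP (adj u x)) (boolP (adj u y)) => ux [] uy //.
  by have := triangle u x y uI xI yI ux uy; rewrite xy.
have [_ [p' [q' [Mx My p'I q'I p'q']]]] := missed_edge xI yI xy.
have p'p : p' != p.
  apply: contraTneq xy => e; rewrite e in Mx.
  by rewrite (missed_inj _ _ _ xI uI Mx Mu).
have q'p : q' != p.
  apply: contraTneq xy => e; rewrite e in My.
  by rewrite (missed_inj _ _ _ yI uI My Mu) adj_sym.
(* An outer edge x y outside the neighbourhood of u would make u, x and y miss all
   three vertices of I, leaving no other outer vertex to miss q, as v does. *)
have : q \in [set p; p'; q'].
  suff -> : [set p; p'; q'] = I by [].
  apply/eqP; rewrite eqEcard cardI; apply/andP; split.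
    by apply/subsetP=> s; rewrite !inE => /orP[/orP[]|]/eqP->.
  by rewrite setUC cardsU1 cards2 !inE negb_or q'p eq_sym p'q' eq_sym p'p.
rewrite !inE eq_sym (negbTE pq) => /orP[]/eqP e; rewrite e in Mv.
  by rewrite (missed_inj _ _ _ xI vI Mx Mv) uv in ux.
by rewrite (missed_inj _ _ _ yI vI My Mv) uv in uy.
Qed.

(** Colour each vertex of [I] by itself and each outer vertex by the vertex of [I]
    that it misses; adjacent outer vertices miss different ones. *)
Lemma colourable3_missing : #|I| = 3 ->
  (forall w, w \notin I -> missed w != set0) -> colourable G 3.
Proof.
move=> cardI Mne.
pose f x := if x \in I then x else odflt x [pick s in missed x].
have fM x : x \notin I -> f x \in missed x.
  move=> xI; rewrite /f (negbTE xI); case: pickP => //= none.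
  by case/set0Pn: (Mne x xI) => s; rewrite none.
have fI x : f x \in I.
  have [xI|xI] := boolP (x \in I); first by rewrite /f xI.
  by have := fM x xI; rewrite missedP => /andP[].
apply/colourableP; exists (fun x => index (f x) (enum I)) => [x|x y xy].
  by rewrite -cardI cardE index_mem mem_enum.
apply/negP=> /eqP/(congr1 (nth x (enum I))); rewrite !nth_index ?mem_enum // => fxy.
have [xI|xI] := boolP (x \in I).
  have [yI|yI] := boolP (y \in I); first by have := Ist xI yI; rewrite xy.
  by have := fM y yI; rewrite -fxy /f xI missedP adj_sym xy andbF.
have [yI|yI] := boolP (y \in I).
  by have := fM x xI; rewrite fxy /f yI missedP xy andbF.
have [_ [p [q [Mx My _ _ /negP]]]] := missed_edge xI yI xy; apply.
have := fM x xI; have := fM y yI; rewrite fxy Mx My !inE => /eqP-> /eqP->.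
exact: eqxx.
Qed.

Lemma colourable3 : colourable G 3.
Proof.
have [/existsP[u /existsP[v /and3P[uI vI uv]]]|noedge] :=
  boolP [exists u, exists v, [&& u \notin I, v \notin I & adj u v]]; last first.
  apply: colourable3_no_edge => x y; rewrite !inE => xI yI.
  apply: contraNN noedge => xy; apply/existsP; exists x; apply/existsP; exists y.
  by rewrite xI yI.
have [/exists_inP[w wI /eqP Mw]|/exists_inPn Mne] :=
  boolP [exists w in ~: I, missed w == set0].
  by apply: colourable3_dominating uI vI uv _ Mw; rewrite inE in wI.
apply: colourable3_missing; first by case: (missed_edge uI vI uv).
by move=> w wI; apply: Mne; rewrite inE.
Qed.

End ThreeColours.

(** K3 is an induced subgraph of the paw and 3K1 one of K1 + P3, so the absence of
    either reduces to a perfect class; the presence of both makes three colours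
    both enough and no more than the clique number. *)
Lemma omega_diamond_codiamond G :
  ~ induced_subgraph D G -> ~ induced_subgraph twoK1_K2 G -> ~ iso G C5 ->
  omega_colourable G.
Proof.
move=> noD noC notC5.
have [K3G|noK3] := induced_subgraph_em nK3 G; last first.
  apply/perfect_omega_colourable/perfect_paw_codiamond => // Z1G; apply: noK3.
  apply: induced_subgraph_trans Z1G; apply: induced_iso_trans (iso_sym iso_Z1).
  decide_embeds.
have [K1G|noK1] := induced_subgraph_em n3K1 G; last first.
  apply/perfect_omega_colourable/perfect_diamond_copaw => // P3G; apply: noK1.
  apply: induced_subgraph_trans P3G; apply: induced_iso_trans (iso_sym iso_K1_P3).
  decide_embeds.
have omega3 : 3 <= clique_number G.
  apply: leq_trans (induced_subgraph_clique_number K3G).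
  have -> : 3 = #|[set: nK3]| by rewrite cardsT card_ord.
  apply: clique_leq_number; apply/cliqueP=> x y _ _ xy.
  by rewrite /adj /= /nat_adj /sym_adj /= andbT.
apply/omega_colourableP; apply: colourable_leq omega3 _.
have [I Ist Imax] := max_stable_ex G; apply: (colourable3 noD noC Ist Imax).
case/induced_subgraphP: K1G => f [f_inj fE].
have -> : 3 = #|[set f x | x in [set: n3K1]]| by rewrite card_imset // cardsT card_ord.
apply: Imax => _ _ /imsetP[x _ ->] /imsetP[y _ ->].
by rewrite fE /adj /= /nat_adj /sym_adj /= /edges !in_nil andbF.
Qed.

(** * The characterisations *)

Lemma pair_is_free X A B G : pair_is X A B -> free X G ->
  ~ induced_subgraph A G /\ ~ induced_subgraph B G.
Proof.
case=> -[/iso_induced_subgraph XA /iso_induced_subgraph XB] [no1 no2].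
  by split; [exact: not_induced_mono XA no1|exact: not_induced_mono XB no2].
by split; [exact: not_induced_mono XB no2|exact: not_induced_mono XA no1].
Qed.

Lemma calP1_perfect X G : calP1 X -> free X G -> ~ iso G C5 -> perfect G.
Proof.
move=> XP fr notC5.
have T_K1P3 : induced_subgraph threeK1 K1_P3.
  by apply: (induced_subgraph_named iso_3K1 iso_K1_P3); vm_compute.
have K3_Z1 : induced_subgraph K3 Z1.
  by apply: (induced_subgraph_named iso_K3 iso_Z1); vm_compute.
case: XP => [XP4|XP|XP|XP].
- apply: P4_free_perfect; case: fr => no1 no2.
  by case: XP4 => XP4; apply: not_induced_mono XP4 _.
- case: XP => /pair_is_free/(_ fr)[/(not_induced_mono T_K1P3) nA nB].
  + exact: perfect_paw_copaw (not_induced_mono K3_Z1 nB) nA notC5.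
  + exact: perfect_paw_copaw nB nA notC5.
  + exact: perfect_diamond_copaw nB nA notC5.
- case: XP => /pair_is_free/(_ fr)[nA nB].
  + exact: perfect_paw_copaw (not_induced_mono K3_Z1 nB) nA notC5.
  + exact: perfect_paw_copaw nB nA notC5.
  + exact: perfect_diamond_copaw nB nA notC5.
- case: XP => /pair_is_free/(_ fr)[nA nB].
  + exact: perfect_paw_codiamond (not_induced_mono K3_Z1 nB) nA notC5.
  + exact: perfect_paw_codiamond nB nA notC5.
Qed.

Theorem theorem1 (X : graph_pair) :
  ((forall G : sgraph, free X G -> ~ iso G C5 -> perfect G) <-> calP1 X) /\
  ((forall G : sgraph, free X G -> ~ iso G C5 -> omega_colourable G) <->
   Omega1 X).
Proof.
split; split.
- exact: perfect_pairs_necessary.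
- by move=> XP G fr notC5; exact: calP1_perfect XP fr notC5.
- exact: omega_pairs_necessary.
case=> [/pair_is_free XD|XP] G fr notC5.
  by case: (XD G fr) => nA nB; exact: omega_diamond_codiamond nB nA notC5.
exact/perfect_omega_colourable/(calP1_perfect XP fr notC5).
Qed.
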